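(* Suppose that $a$ and $c$ are not both $0$, and let $\alpha<\beta$ be real numbers. Then $\sigma(J)=[\alpha,\beta]$ if and only if $\mathcal{E}=[-2R,2R]$ and $$P(\lambda)=\left(\frac{\beta-\alpha}{4}\right)^N\cdot P_N\!\left(\frac{4}{\beta-\alpha}\cdot\Big(\lambda-\frac{\alpha+\beta}{2}\Big)\right),$$ where $R=\left(\frac{\beta-\alpha}{4}\right)^N$.
   Context: Let $N\ge1$ and let $(a_n),(b_n),(c_n)$, $n\in\mathbb{Z}$, be $N$-periodic complex sequences. $J$ is the operator on $\ell^2(\mathbb{Z})$ given by $(Ju)_n=a_nu_{n+1}+b_nu_n+c_{n-1}u_{n-1}$, with spectrum $\sigma(J)$. Put $a=\prod_{i=1}^N a_i$, $c=\prod_{i=1}^N c_i$, and $\mathcal{E}=\{ae^{-i\theta}+ce^{i\theta}\mid\theta\in(-\pi,\pi]\}$. For $\theta\in(-\pi,\pi]$ let $J(\theta)=J_0+J_1e^{i\theta}+J_{-1}e^{-i\theta}$, where $J_0$ is the $N\times N$ tridiagonal matrix with diagonal $b_1,\dots,b_N$, superdiagonal $a_1,\dots,a_{N-1}$, subdiagonal $c_1,\dots,c_{N-1}$; $J_1$ has the single possibly nonzero entry $c_N$ in position $(1,N)$; $J_{-1}$ has the single possibly nonzero entry $a_N$ in position $(N,1)$. Then $\det(\lambda\,\mathrm{Id}-J(\theta))=P(\lambda)-ae^{-i\theta}-ce^{i\theta}$, where $P$ is a monic polynomial of degree $N$ independent of $\theta$, called the discriminant of $J$. It is known that $\sigma(J)=P^{-1}(\mathcal{E})$.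 $P_N$ is the monic real polynomial of degree $N$ determined by $P_N(z+z^{-1})=z^N+z^{-N}$, i.e. $P_N(\lambda)=\left(\frac{\lambda+\sqrt{\lambda^2-4}}{2}\right)^N+\left(\frac{\lambda-\sqrt{\lambda^2-4}}{2}\right)^N$. *)

(* Defs.v *)
From HB Require Import structures.
From mathcomp Require Import all_boot all_order all_algebra.
From mathcomp Require Import complex ring lra zify.
From mathcomp Require Import boolp classical_sets functions set_interval reals.
From mathcomp Require Import constructive_ereal ereal esum trigo.

Set Implicit Arguments.
Unset Strict Implicit.
Unset Printing Implicit Defensive.

Import Order.TTheory GRing.Theory Num.Theory.
Local Open Scope ring_scope.
Local Open Scope complex_scope.
Local Open Scope classical_set_scope.

Section Ell2.
Variable R : realType.
Local Notation C := R[i].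
Implicit Types (u v : int -> C) (T S : (int -> C) -> (int -> C)).

Definition sqnorm2 u : \bar R :=
  \esum_(n in [set: int]) ((Normc.normc (u n)) ^+ 2)%:E.

Definition ell2 : set (int -> C) := [set u | (sqnorm2 u < +oo)%E].

Definition norm2 u : R := Num.sqrt (fine (sqnorm2 u)).

(* Operators on ell2 are represented by maps on all sequences; only their
   action on ell2 matters. *)
Definition bounded_operator T : Prop :=
  [/\ forall u, ell2 u -> ell2 (T u),
      forall (k : C) u v, ell2 u -> ell2 v ->
        T (fun n => k * u n + v n) = (fun n => k * T u n + T v n)
    & exists K : R, forall u, ell2 u -> norm2 (T u) <= K * norm2 u].

Definition resolvent_set T : set C :=
  [set lambda | exists S, bounded_operator S /\
     forall u, ell2 u ->
       S (fun n => lambda * u n - T u n) = u /\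
       (fun n => lambda * S u n - T (S u) n) = u].

Definition spectrum T : set C := ~` resolvent_set T.

End Ell2.

Definition real_segment (R : realType) (x y : R) : set R[i] :=
  [set t%:C | t in `[x, y]].

Section Jacobi.
Variable R : realType.
Local Notation C := R[i].

Definition expi (theta : R) : C := cos theta +i* sin theta.

Definition seq_periodic (N : nat) (u : int -> C) : Prop :=
  forall n : int, u (n + N%:Z) = u n.

Variables (a b c : int -> C).

Definition jacobi (u : int -> C) : int -> C :=
  fun n => a n * u (n + 1) + b n * u n + c (n - 1) * u (n - 1).

Variable N : nat.

Definition period_prod (u : int -> C) : C := \prod_(1 <= i < N.+1) u i%:Z.

Definition Eset : set C :=
  [set period_prod a * expi (- theta) + period_prod c * expi theta
     | theta in `]-pi, pi]].

(* Ordinals start at 0: the matrix index i stands for position i.+1. *)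
Definition J0 : 'M[C]_N := \matrix_(i, j)
  if j == i :> nat then b i.+1%:Z
  else if j == i.+1 :> nat then a i.+1%:Z
  else if i == j.+1 :> nat then c j.+1%:Z
  else 0.

Definition J1 : 'M[C]_N := \matrix_(i, j)
  if (i.+1 == 1)%N && (j.+1 == N)%N then c N%:Z else 0.

Definition Jm1 : 'M[C]_N := \matrix_(i, j)
  if (i.+1 == N)%N && (j.+1 == 1)%N then a N%:Z else 0.

Definition Jmx (theta : R) : 'M[C]_N :=
  J0 + expi theta *: J1 + expi (- theta) *: Jm1.

(* The defining property, with its independence of theta, is [discriminantP]
   below; the value of the characteristic polynomial at theta = 0 fixes it. *)
Definition discriminant : {poly C} :=
  char_poly (Jmx 0) + (period_prod a + period_prod c)%:P.

End Jacobi.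

Arguments seq_periodic {R} N u.

(* [PN] is characterized by [PN_spec] and [PN_unique] below. *)
Fixpoint PN_pair (R : realType) (n : nat) : {poly R} * {poly R} :=
  if n is n'.+1 then
    let: (p, q) := PN_pair R n' in (q, 'X * q - p)
  else (2%:P, 'X).

Definition PN (R : realType) (n : nat) : {poly R} := (PN_pair R n).1.

Section PNTheory.
Variable R : realType.

Lemma PN0 : PN R 0 = 2%:P. Proof. by []. Qed.

Lemma PN1 : PN R 1 = 'X. Proof. by []. Qed.

Lemma PNSS n : PN R n.+2 = 'X * PN R n.+1 - PN R n.
Proof. by rewrite /PN /=; case: (PN_pair R n). Qed.

Lemma PN_horner (F : fieldType) (f : {rmorphism R -> F}) n (z : F) :
  z != 0 -> (map_poly f (PN R n)).[z + z^-1] = z ^+ n + z ^- n.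
Proof.
move=> z0; suff: (map_poly f (PN R n)).[z + z^-1] = z ^+ n + z ^- n /\
  (map_poly f (PN R n.+1)).[z + z^-1] = z ^+ n.+1 + z ^- n.+1 by case.
elim: n => [|n [IH1 IH2]].
  rewrite PN0 PN1 map_polyC map_polyX hornerX hornerC /= rmorph_nat.
  by rewrite !expr1 expr0 invr1.
split=> //; rewrite PNSS rmorphB rmorphM /= map_polyX hornerD hornerN hornerM.
rewrite hornerX IH1 IH2 -!exprVn !exprS; set t := z ^+ n; set w := _ ^+ n.
by field.
Qed.

Lemma PN_spec n (z : R) : z != 0 -> (PN R n).[z + z^-1] = z ^+ n + z ^- n.
Proof.
move=> /(PN_horner idfun n); rewrite (_ : map_poly _ _ = PN R n) //.
by apply/polyP => k; rewrite coef_map.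
Qed.

Lemma PN_lead n :
  size (PN R n.+1) = n.+2 /\ PN R n.+1 \is monic.
Proof.
suff: (size (PN R n.+1) = n.+2 /\ PN R n.+1 \is monic) /\
      (size (PN R n) <= n.+1)%N by case.
elim: n => [|n [[sz mon] szle]].
  by rewrite PN1 PN0 size_polyX monicX size_polyC; case: eqP.
have szM : size ('X * PN R n.+1) = n.+3.
  by rewrite mulrC size_mulX ?sz // -size_poly_eq0 sz.
have lt : (size (- PN R n) < size ('X * PN R n.+1)%R)%N.
  by rewrite size_polyN szM; apply: leq_trans szle _.
rewrite PNSS size_polyDl // szM sz; split=> //; split=> //.
by rewrite monicE lead_coefDl // -monicE monicMl ?monicX.
Qed.

Lemma PN_unique n (p : {poly R}) :
  (forall z : R, z != 0 -> p.[z + z^-1] = z ^+ n + z ^- n) -> p = PN R n.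
Proof.
move=> pE; apply/eqP; rewrite -subr_eq0; set q := p - _.
apply: contraT => q0.
pose s := [seq (k.+1%:R + k.+1%:R^-1 : R) | k <- iota 0 (size q)].
have: (size s < size q)%N.
  apply: max_poly_roots => //.
    apply/allP => _ /mapP[k _ ->]; rewrite rootE /q hornerD hornerN.
    by rewrite pE ?PN_spec ?subrr // pnatr_eq0.
  rewrite map_inj_uniq ?iota_uniq // => k l.
  set x : R := k.+1%:R; set y : R := l.+1%:R => xy.
  have x0 : x != 0 by rewrite pnatr_eq0.
  have y0 : y != 0 by rewrite pnatr_eq0.
  have /eqP : (x - y) * (x * y - 1) = 0.
    have -> : (x - y) * (x * y - 1) = x * y * ((x + x^-1) - (y + y^-1)).
      by move: (x) (y) x0 y0 => x' y' x0 y0; field; rewrite x0 y0.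
    by rewrite xy subrr mulr0.
  rewrite mulf_eq0 !subr_eq0 /x /y => /orP[|].
    by rewrite eqr_nat => /eqP[].
  rewrite -natrM -[1]/(1%:R) eqr_nat.
  by rewrite muln_eq1 => /andP[/eqP[->] /eqP[->]].
by rewrite size_map size_iota ltnn.
Qed.

End PNTheory.

Section CornerDeterminant.
Variable A : comNzRingType.

Lemma det_add_delta m (M : 'M[A]_m) i j x :
  \det (M + x *: delta_mx i j) = \det M + x * cofactor M i j.
Proof.
rewrite !(expand_det_row _ i) [X in _ = _ + X](_ : _ =
  \sum_k (x * (k == j)%:R) * cofactor M i k); last first.
  rewrite (bigD1 j) //= eqxx mulr1 big1 ?addr0 // => k /negPf ->.
  by rewrite mulr0 mul0r.
rewrite -big_split /=; apply: eq_bigr => k _.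
rewrite !mxE eqxx /= mulrDl; congr (_ * _ + _ * _); rewrite /cofactor;
  congr (_ * \det _); apply/matrixP => u v; rewrite !mxE;
  by rewrite eq_sym (negPf (neq_lift _ _)) mulr0 addr0.
Qed.

Lemma det_corners n (B : 'M[A]_n.+2) :
  (forall i j : 'I_n.+2, (i.+1 < j)%N || (j.+1 < i)%N -> B i j = 0) ->
  exists k : A, forall x y : A,
    \det (B + y *: delta_mx ord_max ord0 + x *: delta_mx ord0 ord_max) =
    \det B
    + y * ((-1) ^+ n.+1 * \prod_(i < n.+1) B (inord i) (inord i.+1))
    + x * ((-1) ^+ n.+1 * \prod_(i < n.+1) B (inord i.+1) (inord i))
    + x * y * k.
Proof.
move=> tri; pose M := row' ord0 (col' ord_max B).
have detM : \det M = \prod_(i < n.+1) B (inord i.+1) (inord i).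
  rewrite -det_tr det_trig.
    apply: eq_bigr => i _; rewrite !mxE; congr (B _ _); apply/val_inj.
      by rewrite /= inordK //= ltnS.
    by apply: etrans (lift_max _) _; rewrite /= inordK // ltnS ltnW.
  apply/is_trig_mxP => i j ij; rewrite !mxE tri // lift_max /= /bump /= add1n.
  by rewrite !ltnS ij orbT.
pose M' := row' ord_max (col' ord0 B).
have detM' : \det M' = \prod_(i < n.+1) B (inord i) (inord i.+1).
  rewrite det_trig.
    apply: eq_bigr => i _; rewrite !mxE; congr (B _ _); apply/val_inj.
      by apply: etrans (lift_max _) _; rewrite /= inordK // ltnS ltnW.
    by rewrite /= inordK //= ltnS.
  apply/is_trig_mxP => i j ij; rewrite !mxE tri // lift_max /= /bump /= add1n.
  by rewrite !ltnS ij.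
exists ((-1) ^+ n.+1 * cofactor M ord_max ord0) => x y.
rewrite !det_add_delta; have -> : cofactor B ord_max ord0 =
    (-1) ^+ n.+1 * \prod_(i < n.+1) B (inord i) (inord i.+1).
  by rewrite /cofactor -/M' detM' /= addn0.
rewrite [cofactor (B + _) _ _]/cofactor /= add0n.
have -> : row' ord0 (col' ord_max (B + y *: delta_mx ord_max ord0)) =
    M + y *: delta_mx ord_max ord0.
  apply/matrixP => i j; rewrite !mxE; congr (_ + _ * (_ && _)%:R).
  by rewrite -!val_eqE; congr (_ == _); apply: lift_max.
rewrite det_add_delta detM !mulrDr !addrA; congr (_ + _).
by rewrite -[RHS]mulrA [in RHS](mulrCA y).
Qed.

End CornerDeterminant.

Section Discriminant.
Variables (R : realType) (a b c : int -> R[i]).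
Local Notation C := R[i].

Lemma expiN theta : expi (- theta) * expi theta = 1 :> C.
Proof.
rewrite /expi cosN sinN; apply/eqP; rewrite eq_complex /= mulNr opprK.
by rewrite -!expr2 cos2Dsin2 mulrC mulNr addrN !eqxx.
Qed.

Lemma expi0 : expi 0 = 1 :> C.
Proof. by rewrite /expi cos0 sin0. Qed.

Lemma char_poly_Jmx (N : nat) (hN : (0 < N)%N) (theta : R) :
  char_poly (Jmx a b c N theta) = discriminant a b c N
    - (period_prod N a * expi (- theta) + period_prod N c * expi theta)%:P.
Proof.
case: N hN => [//|[|n]] _.
  have JE t : Jmx a b c 1 t ord0 ord0 = b 1 + expi t * c 1 + expi (- t) * a 1.
    by rewrite !mxE eqxx.
  have cpE t : char_poly (Jmx a b c 1 t) = 'X - (Jmx a b c 1 t ord0 ord0)%:P.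
    by rewrite /char_poly det_mx11 /char_poly_mx !mxE eqxx mulr1n.
  rewrite /discriminant !cpE !JE oppr0 !expi0 !mul1r /period_prod !big_nat1.
  rewrite -!addrA -!rmorphN -!rmorphD; congr ('X + _%:P).
  by rewrite [_ + - _ in RHS]addrC !opprD; ring.
pose B : 'M[{poly C}]_n.+2 := char_poly_mx (J0 a b c n.+2).
have [|k kP] := @det_corners _ _ B.
  move=> i j ij; rewrite !mxE -val_eqE /=.
  have -> : (i == j :> nat) = false by lia.
  have -> : (j == i :> nat) = false by lia.
  have -> : (j == i.+1 :> nat) = false by lia.
  have -> : (i == j.+1 :> nat) = false by lia.
  by rewrite mulr0n subrr.
have cornersE t : char_poly_mx (Jmx a b c n.+2 t) =
    B + (- (expi (- t) * a n.+2%:Z)%:P) *: delta_mx ord_max ord0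
      + (- (expi t * c n.+2%:Z)%:P) *: delta_mx ord0 ord_max.
  apply/matrixP => i j; rewrite !mxE -!val_eqE /= !eqSS !rmorphD !rmorphM /=.
  rewrite -!addrA; congr (_ + _); rewrite !opprD; congr (_ + _).
  rewrite [RHS]addrC; congr (_ + _).
    by case: ifP => _; rewrite ?mulr1 ?mulr0 ?rmorph0 ?mulr0 ?oppr0 ?mulNr.
  by case: ifP => _; rewrite ?mulr1 ?mulr0 ?rmorph0 ?mulr0 ?oppr0 ?mulNr.
have prodE (u : int -> C) : period_prod n.+2 u =
    (\prod_(i < n.+1) u i.+1%:Z) * u n.+2%:Z.
  by rewrite /period_prod big_add1 /= big_mkord big_ord_recr.
have signE (f : 'I_n.+1 -> {poly C}) :
    (-1) ^+ n.+1 * \prod_i f i = \prod_i - f i.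
  by rewrite prodrN card_ord.
have upE : (-1) ^+ n.+1 * \prod_(i < n.+1) B (inord i) (inord i.+1) =
    (\prod_(i < n.+1) a i.+1%:Z)%:P.
  rewrite signE rmorph_prod /=.
  apply: eq_bigr => i _; have ilt := ltn_ord i.
  rewrite !mxE -val_eqE /= !inordK; try lia.
  by rewrite ltn_eqF // gtn_eqF // eqxx mulr0n sub0r opprK.
have dnE : (-1) ^+ n.+1 * \prod_(i < n.+1) B (inord i.+1) (inord i) =
    (\prod_(i < n.+1) c i.+1%:Z)%:P.
  rewrite signE rmorph_prod /=.
  apply: eq_bigr => i _; have ilt := ltn_ord i.
  rewrite !mxE -val_eqE /= !inordK; try lia.
  rewrite gtn_eqF // ltn_eqF // (_ : (i == i.+2 :> nat) = false); last by lia.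
  by rewrite eqxx mulr0n sub0r opprK.
rewrite /discriminant /char_poly !cornersE !kP upE dnE !prodE.
have := expiN theta; rewrite oppr0 !expi0 => /(congr1 polyC).
rewrite !rmorphD !rmorphM /= !rmorph1 => e.
move: e; set X := (expi (- theta))%:P; set Y := (expi theta)%:P => e.
set p := \det B; set an := (a _)%:P; set cn := (c _)%:P.
set pa := (\prod_(i < _) a _)%:P; set pc := (\prod_(i < _) c _)%:P.
have -> : - (Y * cn) * - (X * an) * k = (X * Y) * (cn * an * k) by ring.
by rewrite e; ring.
Qed.

Lemma discriminantP (N : nat) (hN : (0 < N)%N) (theta : R) (lambda : C) :
  \det (lambda%:M - Jmx a b c N theta) =
  (discriminant a b c N).[lambda]
    - period_prod N a * expi (- theta) - period_prod N c * expi theta.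
Proof.
have -> : \det (lambda%:M - Jmx a b c N theta) =
    (char_poly (Jmx a b c N theta)).[lambda].
  rewrite /char_poly -horner_evalE -det_map_mx; congr (\det _).
  apply/matrixP => i j; rewrite !mxE /= horner_evalE hornerD hornerN hornerC.
  by rewrite hornerMn hornerX.
by rewrite char_poly_Jmx // hornerD hornerN hornerC opprD addrA.
Qed.

Lemma discriminant_lead (N : nat) (hN : (0 < N)%N) :
  size (discriminant a b c N) = N.+1 /\ discriminant a b c N \is monic.
Proof.
have lt : (size ((period_prod N a + period_prod N c)%:P : {poly C})
           < size (char_poly (Jmx a b c N 0)))%N.
  by rewrite size_char_poly; apply: leq_ltn_trans (size_polyC_leq1 _) _.
rewrite /discriminant size_polyDl // size_char_poly; split=> //.
by rewrite monicE lead_coefDl // -monicE char_poly_monic.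
Qed.

End Discriminant.

(* Main.v *)
Require Import Defs.
From mathcomp Require Import all_boot all_order all_algebra.
From mathcomp Require Import complex ring lra zify polyrcf.
From mathcomp Require Import boolp classical_sets functions set_interval reals.
From mathcomp Require Import finmap cardinality fsbigop.
From mathcomp Require Import topology normedtype sequences.
From mathcomp Require Import constructive_ereal ereal esum trigo.

Set Implicit Arguments.
Unset Strict Implicit.
Unset Printing Implicit Defensive.

(* Writing T for the shift by N, Cayley-Hamilton on Floquet sequences gives
   P(J) = a T + c T^-1. Hence P(l) - a T - c T^-1 = (l - J) Q(J) for a polynomial Q;
   its left-hand side is, up to T^-1, a polynomial in T whose roots avoid the unit circle
   exactly when P(l) is not in E, so then l - J is invertible. Conversely, truncated
   Floquet eigenvectors show that l is in the spectrum as soon as P(l) is in E.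
   If |a| <> |c|, then 0 is strictly inside the ellipse E, and a vertical ray from a root
   of P reaches a non-real point of P^-1(E). So a real spectrum forces |a| = |c|, and
   after normalization P is a polynomial p with p^-1([-2,2]) = [-2,2]. Every root of p -+ 2
   inside ]-2,2[ is then of even order, so with x = z + 1/z both z^N (2 - p) and
   z^N (2 + p) are squares of polynomials A, B in z; the factors of
   (B + iA) (B - iA) = 4 z^N are monomials, which gives p = P_N or p = - P_N. *)

Import Order.TTheory GRing.Theory Num.Theory.
Import numFieldNormedType.Exports.
Local Open Scope ring_scope.
Local Open Scope complex_scope.
Local Open Scope classical_set_scope.

(** * The unit circle and the Joukowski map *)

Section Circle.
Variable R : realType.
Local Notation C := R[i].
Implicit Types (z w l : C) (t : R).

(** Invertibility travels as [ell2_iso], which includes a bound on preimages, so a bounded inverse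
    of l - J is assembled from the inverses of factors T - z. Each of these is a Neumann series,
    summed pointwise while a bound uniform in the partial sums controls the squared norm.
    Cayley-Hamilton speaks only of Floquet sequences with a multiplier on the unit circle. The
    formula reaches every sequence because both sides at n see finitely many terms: near n the
    sequence agrees with one of period 4N, which splits into four Floquet sequences. The square
    argument tolerates simple roots at the ends because x - 2 = (z - 1)^2 / z and x + 2 = (z + 1)^2
    / z are squares up to the factor 1/z. To cross the ellipse, a real-linear map sends it to a
    circle; along the ray the crossing becomes a sign change of a real polynomial. When |a| = |c|, E
    is s [-2, 2] with s^2 = ac. The free sign of s matches the sign in p = P_N or p = - P_N, and
    comparing leading coefficients, P being monic, settles both: s is h^N up to that sign, with h =
    (beta - alpha)/4. *)

Lemma real_segmentP (x y : R) l :
  real_segment x y l <-> exists t, [/\ x <= t, t <= y & l = t%:C].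
Proof.
split=> [[t /=]|[t [xt ty ->]]].
  by rewrite in_itv /= => /andP[xt ty] <-; exists t.
by exists t => //=; rewrite in_itv /= xt ty.
Qed.

Lemma circle_neq0 z : Normc.normc z = 1 -> z != 0.
Proof.
by move=> z1; apply: contra_eq_neq z1 => ->; rewrite Normc.normc0 eq_sym oner_eq0.
Qed.

Lemma circleV z : Normc.normc z = 1 -> z^-1 = z^*%C.
Proof.
case: z => x y h /=; have {h}: x ^+ 2 + y ^+ 2 = 1.
  by move: h => /= /(congr1 (fun t => t ^+ 2)); rewrite sqr_sqrtr ?expr1n //; nra.
by move=> h; apply/eqP; rewrite eq_complex /= h !divr1 !eqxx.
Qed.

Lemma circleP (x y : R) :
  Normc.normc (x +i* y) = 1 <-> x ^+ 2 + y ^+ 2 = 1.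
Proof.
split=> [/= /(congr1 (fun t => t ^+ 2))|/= ->]; last exact: sqrtr1.
by rewrite sqr_sqrtr ?expr1n //; nra.
Qed.

(** The witness is a root of z^2 - l z + 1; the other root, (l - s) / 2, is its inverse because the
    product of the roots is 1. *)
Lemma joukowski_surj l : exists2 z, z != 0 & l = z + z^-1.
Proof.
pose s := sqrtc (l ^+ 2 - 4).
have s2 : s ^+ 2 = l ^+ 2 - 4 by rewrite sqr_sqrtc.
have e : ((l + s) / 2) * ((l - s) / 2) = 1.
  have -> : ((l + s) / 2) * ((l - s) / 2) = (l ^+ 2 - s ^+ 2) / 4 by field.
  by rewrite s2; field.
have z0 : (l + s) / 2 != 0.
  by apply: contra_eq_neq e => ->; rewrite mul0r eq_sym oner_eq0.
exists ((l + s) / 2) => //.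
have -> : ((l + s) / 2)^-1 = (l - s) / 2 by rewrite -[RHS](mulKf z0) e mulr1.
by field.
Qed.

Lemma joukowski_inj z w :
  z != 0 -> w != 0 -> z + z^-1 = w + w^-1 -> z = w \/ z = w^-1.
Proof.
move=> z0 w0 e.
have /eqP : (z - w) * (z * w - 1) = 0.
  have -> : (z - w) * (z * w - 1) = z * w * ((z + z^-1) - (w + w^-1)).
    by field; rewrite z0 w0.
  by rewrite e subrr mulr0.
rewrite mulf_eq0 !subr_eq0 => /orP[/eqP|/eqP zw]; first by left.
by right; rewrite -[z](mulfK w0) zw mul1r.
Qed.

Lemma joukowski_circle z : z != 0 ->
  real_segment (-2) 2 (z + z^-1) <-> Normc.normc z = 1.
Proof.
move=> z0; rewrite real_segmentP; split; last first.
  move=> z1; rewrite (circleV z1).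
  case: z {z0} z1 => x y /circleP e; exists (x + x); split; [nra|nra|].
  by apply/eqP; rewrite eq_complex /= subrr !eqxx.
move=> [t [t2 t2' zt]].
(* The point of the unit circle with real part t / 2 has the same image t as [z], so [z] is [w] or
   its inverse. *)
pose w : C := (t / 2) +i* Num.sqrt (1 - (t / 2) ^+ 2).
have w1 : Normc.normc w = 1.
  by apply/circleP; rewrite sqr_sqrtr; [ring|nra].
have /joukowski_inj [] // : z + z^-1 = w + w^-1.
- rewrite zt circleV //; apply/eqP; rewrite eq_complex /= subrr eqxx andbT.
  by apply/eqP; field.
- exact: circle_neq0.
- by move=> ->.
- by move=> ->; rewrite Normc.normcV w1 invr1.
Qed.

Lemma normcX z n : Normc.normc (z ^+ n) = Normc.normc z ^+ n.
Proof.
elim: n => [|n IH]; first by rewrite !expr0 Normc.normc1.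
by rewrite !exprS Normc.normcM IH.
Qed.

Lemma normc_ge0 z : 0 <= Normc.normc z.
Proof. by case: z => x y; apply: sqrtr_ge0. Qed.

(** In the coordinate z with l = z + 1/z the polynomial acts as z -> z^n, and |z^n| = 1 exactly when
    |z| = 1. *)
Lemma PN_preimage n l : (0 < n)%N ->
  real_segment (-2) 2 (map_poly (real_complex R) (PN R n)).[l] <->
  real_segment (-2) 2 l.
Proof.
move=> n0; have [z z0 ->] := joukowski_surj l.
rewrite PN_horner // !joukowski_circle ?expf_neq0 // normcX.
split=> [h|->]; last by rewrite expr1n.
by apply/eqP; rewrite -(@pexpr_eq1 _ _ n) // ?h ?normc_ge0.
Qed.

Lemma expi_circle (t : R) : Normc.normc (expi t) = 1.
Proof. by apply/circleP; exact: cos2Dsin2. Qed.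

Lemma expiV (t : R) : expi (- t) = (expi t)^-1 :> C.
Proof.
have := expiN t; move/(congr1 (fun x => x / expi t)).
by rewrite mulfK ?mul1r // circle_neq0 // expi_circle.
Qed.

Lemma circle_expi z : Normc.normc z = 1 -> exists2 t, - pi < t <= pi & z = expi t.
Proof.
case: z => x y /circleP e.
have x1 : -1 <= x <= 1 by apply/andP; split; nra.
have [y0|y0] := leP 0 y.
  exists (acos x).
    rewrite acos_lepi // andbT (lt_le_trans _ (acos_ge0 _)) //.
    by rewrite oppr_lt0 pi_gt0.
  rewrite /expi acosK // sin_acos //; congr (_ +i* _).
  by rewrite -[LHS]ger0_norm // -sqrtr_sqr; congr Num.sqrt; lra.
(* Since y < 0 excludes x = -1, the angle stays strictly above -pi, as the half-open interval
   demands. *)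
exists (- acos x).
  rewrite ltrN2; apply/andP; split; last first.
    by rewrite (le_trans _ (pi_ge0 R)) // oppr_le0 acos_ge0.
  by apply: acos_ltpi; case/andP: x1 => x1 ->; rewrite andbT; nra.
rewrite /expi cosN sinN acosK // sin_acos //; congr (_ +i* _).
apply: oppr_inj; rewrite opprK.
by rewrite -[LHS]gtr0_norm ?oppr_gt0 // -sqrtr_sqr; congr Num.sqrt; nra.
Qed.

Lemma EsetE (a c : int -> C) N :
  Eset a c N = [set period_prod N a / z + period_prod N c * z
                 | z in [set z : C | Normc.normc z = 1]].
Proof.
apply/seteqP; split=> [l [t _ <-]|l [z /= z1 <-]].
  by exists (expi t); [exact: expi_circle | rewrite expiV].
have [t tI ->] := circle_expi z1; exists t.
  by rewrite /= in_itv.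
by rewrite expiV.
Qed.

End Circle.

(** * Polynomials preserving the segment [-2, 2] *)

Section Chebyshev.
Variable R : realType.
Local Notation C := R[i].
Implicit Types (p q : {poly R}) (P Q A B : {poly C}).

(** Continuity along the segment from [t] to [t + d]: the sign of [d] chooses the side of approach,
    and its size keeps the points where nonnegativity is known. *)
Lemma poly_ge0_at p (t d : R) : d != 0 ->
  (forall s, 0 < s <= 1 -> 0 <= p.[t + s * d]) -> 0 <= p.[t].
Proof.
move=> d0 ge0; rewrite leNgt; apply/negP => pt.
have [|e e0 pc] := @poly_cont _ t p (- p.[t]); first by rewrite oppr_gt0.
have dn0 : 0 < `|d| by rewrite normr_gt0.
pose s := Num.min 1 (e / 2 / `|d|).
have s01 : 0 < s <= 1.
  by rewrite /s lt_min ltr01 /= ge_min lexx andbT !divr_gt0.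
have /pc : `|t + s * d - t| < e.
  rewrite addrAC subrr add0r normrM (gtr0_norm (andP s01).1).
  apply: (@le_lt_trans _ _ (e / 2)); last by lra.
  by rewrite -ler_pdivlMr // /s ge_min lexx orbT.
by have := ge0 _ s01; rewrite ltr_norml => ? /andP[? ?]; lra.
Qed.

(** If P - Q is nonzero, so is its product with ['X]; a point where that product does not vanish is
    nonzero and separates P from Q. *)
Lemma polyC_ext P Q : (forall z, z != 0 -> P.[z] = Q.[z]) -> P = Q.
Proof.
move=> e; apply/eqP; rewrite -subr_eq0; apply: contraT => PQ0.
have /closed_nonrootP[x] : 'X * (P - Q) != 0 by rewrite mulf_neq0 ?polyX_eq0.
rewrite rootE !(hornerE, hornerM, hornerN) mulf_eq0 negb_or subr_eq0.
by case/andP=> /e -> /eqP.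
Qed.

(** Induction on the degree, removing a root t of p. With x = z + 1/z, an end t = 2 or t = -2
    contributes (z - 1)^2 / z or (z + 1)^2 / z. An interior root is at least double by the sign of
    p, and (x - t)^2 = (z^2 - t z + 1)^2 / z^2. *)
Lemma joukowski_square p : p != 0 ->
    (forall x, -2 <= x <= 2 -> 0 <= p.[x]) ->
    (forall l, root (map_poly (real_complex R) p) l -> real_segment (-2) 2 l) ->
  exists A, forall z, z != 0 ->
    A.[z] ^+ 2 = z ^+ (size p).-1 * (map_poly (real_complex R) p).[z + z^-1].
Proof.
have [n] := ubnP (size p); elim: n p => // n IH p szp p0 pge proot.
have [sz1|] := eqVneq (size (map_poly (real_complex R) p)) 1%N.
  have /eqP/size_poly1P[k k0 pk] : size p = 1%N by rewrite -sz1 size_map_poly.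
  exists (sqrtc k%:C)%:P => z z0; rewrite pk map_polyC !hornerC size_polyC k0.
  by rewrite expr0 mul1r sqr_sqrtc.
case/closed_rootP => l lroot; have := proot _ lroot.
rewrite real_segmentP => -[t [t1 t2 lt]].
have /factor_theorem[q pq] : root p t by move: lroot; rewrite lt fmorph_root.
have q0 : q != 0 by apply: contra_neq p0 => q0; rewrite pq q0 mul0r.
have szpq : size p = (size q).+1 by rewrite pq size_Mmonic ?monicXsubC // size_XsubC addn2.
have rootq l' : root (map_poly (real_complex R) q) l' -> real_segment (-2) 2 l'.
  by move=> h; apply: proot; rewrite pq rmorphM rootM h.
have pE x : p.[x] = q.[x] * (x - t) by rewrite pq hornerM hornerXsubC.
have szq : (size q < n)%N by rewrite -ltnS -szpq.
have mapqE z : (map_poly (real_complex R) p).[z] =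
    (map_poly (real_complex R) q).[z] * (z - t%:C).
  by rewrite pq rmorphM /= map_polyXsubC hornerM hornerXsubC.
have szq1 : size q = (size q).-1.+1 by rewrite -polySpred.
have [te|tn2] := eqVneq t 2.
  (* Left of 2 the factor x - 2 is negative, so the induction hypothesis applies to -q; the factor i
     in the witness restores the sign. *)
  have [|||l' hl'|A hA] := IH (- q).
  - by rewrite size_polyN.
  - by rewrite oppr_eq0.
  - move=> x hx.
    have lt2 y : -2 <= y < 2 -> 0 <= (- q).[y].
      move=> hy; have := pge y; rewrite pE te hornerN => hh.
      by have := hh ltac:(lra); nra.
    have [->|x2] := eqVneq x 2; last by apply: lt2; lra.
    apply: (@poly_ge0_at _ 2 (-1)) => [|s s01]; first by lra.
    by apply: lt2; lra.
  - by apply: rootq; move: hl'; rewrite rmorphN rootN.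
  exists (A * ('i%C *: ('X - 1))) => z z0.
  rewrite hornerM exprMn hA // szpq size_polyN rmorphN mapqE te /= hornerN.
  rewrite szq1 [z ^+ _.+1]exprS /= hornerZ hornerD hornerN hornerX hornerC exprMn sqr_i.
  by rewrite rmorph_nat; field.
have [te|tnN2] := eqVneq t (-2).
  have [|||l' hl'|A hA] := IH q => //.
  - move=> x hx.
    have gt2 y : -2 < y <= 2 -> 0 <= q.[y].
      move=> hy; have := pge y; rewrite pE te => hh.
      by have := hh ltac:(lra); nra.
    have [->|x2] := eqVneq x (-2); last by apply: gt2; lra.
    apply: (@poly_ge0_at _ (-2) 1) => [|s s01]; first by lra.
    by apply: gt2; lra.
  - by apply: rootq.
  exists (A * ('X + 1)) => z z0.
  rewrite hornerM exprMn hA // szpq mapqE te /=.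
  rewrite szq1 [z ^+ _.+1]exprS /= hornerD hornerX hornerC.
  by rewrite rmorphN rmorph_nat; field.
have qgt x : t < x <= 2 -> 0 <= q.[x].
  by move=> hx; have := pge x ltac:(lra); rewrite pE; nra.
have qlt x : -2 <= x < t -> 0 <= (- q).[x].
  by move=> hx; have := pge x ltac:(lra); rewrite pE hornerN; nra.
(* q is nonnegative to the right of t and nonpositive to the left, so it vanishes at t and a second
   factor x - t splits off. *)
have qt : q.[t] = 0.
  apply/eqP; rewrite eq_le; apply/andP; split.
    rewrite -oppr_ge0 -hornerN; apply: (@poly_ge0_at _ t (- (t + 2))) => [|s s01].
      by lra.
    by apply: qlt; nra.
  apply: (@poly_ge0_at _ t (2 - t)) => [|s s01]; first by lra.
  by apply: qgt; nra.
have /factor_theorem[u qu] : root q t by rewrite rootE qt.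
have u0 : u != 0 by apply: contra_neq q0 => u0; rewrite qu u0 mul0r.
have szqu : size q = (size u).+1 by rewrite qu size_Mmonic ?monicXsubC // size_XsubC addn2.
have quE x : q.[x] = u.[x] * (x - t) by rewrite qu hornerM hornerXsubC.
have mapuE z : (map_poly (real_complex R) q).[z] =
    (map_poly (real_complex R) u).[z] * (z - t%:C).
  by rewrite qu rmorphM /= map_polyXsubC hornerM hornerXsubC.
have [|||l' hl'|A hA] := IH u => //.
- by rewrite szqu in szq; apply: ltnW.
- move=> x hx; have ugt y : t < y <= 2 -> 0 <= u.[y].
    by move=> hy; have := qgt y hy; rewrite quE; nra.
  have [xt|xt|->] := ltgtP x t; last first.
  + apply: (@poly_ge0_at _ t (2 - t)) => [|s s01]; first by lra.
    by apply: ugt; nra.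
  + by apply: ugt; lra.
  + by have := qlt x ltac:(lra); rewrite hornerN quE; nra.
- by apply: rootq; rewrite qu rmorphM rootM hl'.
exists (A * ('X ^+ 2 - t%:C *: 'X + 1)) => z z0.
have szu1 : size u = (size u).-1.+1 by rewrite -polySpred.
rewrite hornerM exprMn hA // szpq szqu mapqE mapuE szu1 ![z ^+ _.+1]exprS /=.
rewrite !hornerD hornerN hornerZ hornerX hornerC hornerXn.
by field.
Qed.

Lemma poly_ReIm P : exists re im : {poly R},
  P = map_poly (real_complex R) re + 'i%C *: map_poly (real_complex R) im.
Proof.
exists (\poly_(i < size P) complex.Re P`_i), (\poly_(i < size P) complex.Im P`_i).
by apply/polyP => i; rewrite coefD coefZ !coef_map; exact: complexE.
Qed.

(** The polynomial of imaginary parts vanishes at 1, 1/2, 1/3, ..., more points of the segment than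
    its degree allows. *)
Lemma real_on_segment P :
    (forall t, -2 <= t <= 2 -> exists s : R, P.[t%:C] = s%:C) ->
  exists p, P = map_poly (real_complex R) p.
Proof.
move=> Preal; have [re [im PE]] := poly_ReIm P.
exists re; rewrite [LHS]PE (_ : im = 0) ?rmorph0 ?scaler0 ?addr0 //.
apply/eqP; apply: contraT => im0.
pose s := [seq (k.+1%:R^-1 : R) | k <- iota 0 (size im)].
have: (size s < size im)%N.
  apply: max_poly_roots => //; last first.
    rewrite map_inj_uniq ?iota_uniq // => k l /invr_inj /eqP.
    by rewrite eqr_nat => /eqP[].
  apply/allP => _ /mapP[k _ ->]; rewrite rootE.
  have k1 : 0 < (k.+1%:R^-1 : R) <= 1.
    by apply/andP; split; [rewrite invr_gt0 ltr0n|rewrite invf_le1 ?ler1n ?ltr0n].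
  move: {s} (k.+1%:R^-1 : R) k1 => x k1; have [|r] := Preal x; first by lra.
  rewrite PE hornerD hornerZ !horner_map /= => /(congr1 (@complex.Im R)) /=.
  by rewrite mul0r mul1r !add0r => ->.
by rewrite size_map size_iota ltnn.
Qed.

Lemma chebyshev_unique P n : size P = n.+2 ->
    (forall l, real_segment (-2) 2 P.[l] <-> real_segment (-2) 2 l) ->
  exists k : R, (k = 1 \/ k = -1) /\
    P = k%:C *: map_poly (real_complex R) (PN R n.+1).
Proof.
move=> szP PP.
have seg t : -2 <= t <= 2 -> real_segment (-2) 2 P.[t%:C].
  by move=> /andP[t1 t2]; apply/PP/real_segmentP; exists t.
have [|q Pq] := @real_on_segment P.
  by move=> t /seg /real_segmentP[s [_ _ sP]]; exists s.
have szq : size q = n.+2 by rewrite -szP Pq size_map_poly.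
have qb t : -2 <= t <= 2 -> -2 <= q.[t] <= 2.
  move=> /seg; rewrite Pq horner_map /= => /real_segmentP[s [s1 s2 /complexI ->]].
  by rewrite s1.
have sz2 : (size (2%:P : {poly R}) < n.+2)%N.
  by rewrite (leq_ltn_trans (size_polyC_leq1 _)).
have sz1 : size (2%:P - q) = n.+2.
  by rewrite addrC size_polyDl size_polyN szq.
have szD : size (2%:P + q) = n.+2 by rewrite addrC size_polyDl szq.
have two : real_complex R 2 = 2 by rewrite rmorph_nat.
have [|||A hA] := @joukowski_square (2%:P - q).
- by rewrite -size_poly_eq0 sz1.
- by move=> x hx; rewrite hornerD hornerN hornerC; have := qb x hx; lra.
- move=> l; rewrite rmorphB /= map_polyC /= two -Pq rootE hornerD hornerN hornerC.
  rewrite subr_eq0 => /eqP Pl; apply/PP; rewrite -Pl.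
  by apply/real_segmentP; exists 2; split; [lra|lra|rewrite two].
have [|||B hB] := @joukowski_square (2%:P + q).
- by rewrite -size_poly_eq0 szD.
- by move=> x hx; rewrite hornerD hornerC; have := qb x hx; lra.
- move=> l; rewrite rmorphD /= map_polyC /= two -Pq rootE hornerD hornerC.
  rewrite addrC addr_eq0 => /eqP Pl; apply/PP; rewrite Pl.
  by apply/real_segmentP; exists (-2); split; [lra|lra|rewrite -two -rmorphN].
have eB : map_poly (real_complex R) (2%:P - q) = 2%:P - P.
  by rewrite rmorphB /= map_polyC /= two -Pq.
have eD : map_poly (real_complex R) (2%:P + q) = 2%:P + P.
  by rewrite rmorphD /= map_polyC /= two -Pq.
move: hA hB; rewrite sz1 szD eB eD => hA hB {eB eD}.
(* B^2 + A^2 evaluates to z^(n+1) ((2 + P) + (2 - P)), from which P drops out. *)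
have AB : (B + 'i%C *: A) * (B - 'i%C *: A) = 4 *: 'X^(n.+1).
  apply: polyC_ext => z z0; have := hA z z0; have := hB z z0.
  rewrite hornerM !hornerD hornerN !hornerZ hornerXn hornerC => eB eA.
  rewrite hornerN hornerZ.
  transitivity (B.[z] ^+ 2 - 'i%C ^+ 2 * A.[z] ^+ 2); first by ring.
  by rewrite sqr_i eA eB; ring.
have /dvdp_exp_XsubCP[m mn] : B + 'i%C *: A %| ('X - 0%:P) ^+ n.+1.
  by rewrite subr0 -(@dvdpZr _ 4) ?pnatr_eq0 // -AB dvdp_mulr.
rewrite subr0 => /eqpP[[u1 u2] /= /andP[u10 u20] eB].
pose u := u2 / u1.
have u0 : u != 0 by rewrite mulf_neq0 ?invr_eq0.
have {}eB : B + 'i%C *: A = u *: 'X^m.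
  by apply: (scalerI u10); rewrite eB scalerA /u mulrCA divff ?mulr1.
have eA : B - 'i%C *: A = (4 / u) *: 'X^(n.+1 - m).
  have Xm0 : 'X^m != 0 :> {poly C} by rewrite expf_neq0 ?polyX_eq0.
  apply: (mulfI (_ : u *: 'X^m != 0)); first by rewrite scaler_eq0 negb_or u0.
  rewrite -eB AB eB -scalerAl -scalerAr scalerA -exprD subnKC //.
  by congr (_ *: _); field.
(* P is recovered from the two monomial factors: 2 z^(n+1) P = B^2 - A^2, and (B + iA)^2 + (B -
   iA)^2 = 2 (B^2 - A^2). *)
have PJ z : z != 0 -> P.[z + z^-1] * z ^+ n.+1 =
    u ^+ 2 / 4 * z ^+ (m * 2) + (u ^+ 2 / 4)^-1 * z ^+ ((n.+1 - m) * 2).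
  move=> z0; have := hA z z0; have := hB z z0.
  rewrite hornerD hornerD hornerN hornerC => fB fA.
  have := congr1 (fun f => f.[z]) eB; have := congr1 (fun f => f.[z]) eA.
  rewrite /= !hornerD hornerN !hornerZ !hornerXn => gA gB.
  have -> : P.[z + z^-1] * z ^+ n.+1 = (B.[z] ^+ 2 - A.[z] ^+ 2) / 2.
    by rewrite fA fB; field.
  have -> : (B.[z] ^+ 2 - A.[z] ^+ 2) / 2 =
      ((B.[z] + 'i%C * A.[z]) ^+ 2 + (B.[z] - 'i%C * A.[z]) ^+ 2) / 4.
    have := sqr_i R; set I := 'i%C => I2.
    have -> : A.[z] ^+ 2 = - (I ^+ 2 * A.[z] ^+ 2) by rewrite I2; ring.
    by field.
  by rewrite gA gB !exprM; move: (z ^+ m) (z ^+ _) => x y; field.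
(* The exponents 2m and 2(n+1-m) are symmetric about n+1, so dividing by z^(n+1) leaves opposite
   exponents with d = |2m - (n+1)|; the constant is inverted when 2m < n+1. *)
have [k [d [k0 PK]]] : exists k d, k != 0 /\ forall z, z != 0 ->
    P.[z + z^-1] = k * z ^+ d + k^-1 * z ^- d.
  have k0 : u ^+ 2 / 4 != 0 by rewrite mulf_neq0 ?expf_neq0 // invr_eq0 pnatr_eq0.
  move: (u ^+ 2 / 4) k0 PJ => k k0 PJ.
  have [le|lt] := leqP n.+1 (m * 2).
    exists k, (m * 2 - n.+1)%N; split=> // z z0.
    apply: (mulIf (_ : z ^+ n.+1 != 0)); first by rewrite expf_neq0.
    rewrite PJ // mulrDl -!mulrA -exprD subnK //; congr (_ + _ * _).
    apply: (mulfI (_ : z ^+ (m * 2 - n.+1) != 0)); first by rewrite expf_neq0.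
    by rewrite mulrA mulfV ?expf_neq0 // mul1r -exprD; congr (_ ^+ _); lia.
  exists k^-1, (n.+1 - m * 2)%N; split=> [|z z0]; first by rewrite invr_eq0.
  apply: (mulIf (_ : z ^+ n.+1 != 0)); first by rewrite expf_neq0.
  rewrite PJ // invrK mulrDl -!mulrA -exprD addrC; congr (_ * _ + _ * _).
    by congr (_ ^+ _); lia.
  apply: (mulfI (_ : z ^+ (n.+1 - m * 2) != 0)); first by rewrite expf_neq0.
  by rewrite mulrA mulfV ?expf_neq0 // mul1r -exprD; congr (_ ^+ _); lia.
have d0 : (0 < d)%N.
  rewrite lt0n; apply/eqP => d0.
  have Pc : P = (k + k^-1)%:P.
    apply: polyC_ext => l _; have [z z0 ->] := joukowski_surj l.
    by rewrite PK // d0 !expr0 invr1 !mulr1 hornerC.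
  by have := size_polyC_leq1 (k + k^-1); rewrite -Pc szP.
(* P(z + 1/z) is invariant under z -> 1/z, so the coefficients [k] and [k^-1] agree; z = 2 suffices
   to see it because 4^d is not 1. *)
have kk : k * k = 1.
  have sym z : z != 0 -> k * z ^+ d + k^-1 * z ^- d = k * z ^- d + k^-1 * z ^+ d.
    move=> z0; have z'0 : z^-1 != 0 by rewrite invr_eq0.
    by rewrite -PK // addrC -{2}(invrK z) PK // exprVn invrK.
  have z2 : (2 : C) != 0 by rewrite pnatr_eq0.
  have := sym _ z2; move: sym => _.
  set x : C := 2 ^+ d => /eqP; rewrite -subr_eq0.
  have x1 : (x ^+ 2 - 1) != 0.
    rewrite /x -exprM -natrX subr_eq0 -[1]/(1%:R) eqr_nat.
    by rewrite gtn_eqF // -{1}(expn0 2) ltn_exp2l // muln_gt0 d0.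
  have x0 : x != 0 by rewrite expf_neq0.
  have -> : k * x + k^-1 / x - (k / x + k^-1 * x) =
      (k * k - 1) * (x ^+ 2 - 1) / (k * x).
    by clearbody x; field; rewrite x0 k0.
  rewrite !mulf_eq0 (negPf x1) invr_eq0 mulf_eq0 (negPf k0) (negPf x0) !orbF.
  by rewrite subr_eq0 => /eqP.
have [r [r1 rk]] : exists r : R, (r = 1 \/ r = -1) /\ k = r%:C.
  have /eqP : (k - 1) * (k + 1) = 0 by rewrite -subr_sqr expr2 kk expr1n subrr.
  rewrite mulf_eq0 subr_eq0 addr_eq0 => /orP[/eqP ->|/eqP ->].
    by exists 1; split; [left|rewrite rmorph1].
  by exists (-1); split; [right|rewrite rmorphN rmorph1].
have PE : P = k *: map_poly (real_complex R) (PN R d).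
  apply: polyC_ext => l _; have [z z0 ->] := joukowski_surj l.
  rewrite PK // hornerZ PN_horner // mulrDr; congr (_ + _ * _).
  by rewrite -[RHS](mulKf k0) kk mulr1.
have dn : d = n.+1.
  have := szP; rewrite PE size_scale // size_map_poly.
  by case: (d) d0 => // e _; rewrite (PN_lead R e).1 => -[->].
by exists r; split=> //; rewrite PE dn rk.
Qed.

End Chebyshev.

(** * Square-summable sequences *)

Section SquareSummable.
Variable R : realType.
Local Notation C := R[i].
Local Notation V := (int -> C).
Implicit Types u v w : V.

(** [fine] sends an infinite sum to 0, so the value carries information only on [ell2]; this is why
    the bounds below come paired with membership. *)
Definition nsq u : R := fine (sqnorm2 u).

Definition sshift (s : int) u : V := fun n => u (n + s).

Lemma sqnorm2_ge0 u : (0 <= sqnorm2 u)%E.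
Proof. by apply: esum_ge0 => n _; rewrite lee_fin sqr_ge0. Qed.

Lemma nsq_ge0 u : 0 <= nsq u.
Proof. by rewrite /nsq fine_ge0 // sqnorm2_ge0. Qed.

Lemma nsqE u : ell2 u -> sqnorm2 u = (nsq u)%:E.
Proof.
move=> hu; rewrite /nsq fineK // ge0_fin_numE //; exact: sqnorm2_ge0.
Qed.

Lemma nsq_finite u (B : R) :
    (forall s : seq int, uniq s -> \sum_(n <- s) Normc.normc (u n) ^+ 2 <= B) ->
  ell2 u /\ nsq u <= B.
Proof.
move=> uB; have le : (sqnorm2 u <= B%:E)%E.
  apply: ge_ereal_sup => _ [F [Ffin _] <-].
  by rewrite fsbig_finite //= sumEFin lee_fin; apply: uB; exact: fset_uniq.
have hu : ell2 u by apply: le_lt_trans le _; rewrite ltry.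
by split=> //; rewrite -lee_fin -nsqE.
Qed.

Lemma nsq_ge_sum u (s : seq int) : ell2 u -> uniq s ->
  \sum_(n <- s) Normc.normc (u n) ^+ 2 <= nsq u.
Proof.
move=> hu us; rewrite -lee_fin -nsqE // -sumEFin.
apply: esum_ge; exists [set` s]; first by split => //; exact: finite_seq.
by rewrite fsbig_seq.
Qed.

Lemma normc_le_nsq u n : ell2 u -> Normc.normc (u n) ^+ 2 <= nsq u.
Proof.
by move=> hu; have := @nsq_ge_sum u [:: n] hu isT; rewrite big_seq1.
Qed.

Lemma nsq_eq0 u : ell2 u -> nsq u <= 0 -> u = (fun=> 0).
Proof.
move=> hu u0; apply: funext => n; apply: Normc.eq0_normc; apply/eqP.
by rewrite -sqrf_eq0 eq_le sqr_ge0 andbT; apply: le_trans u0; exact: normc_le_nsq.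
Qed.

Lemma nsq_comb u v w (k l : R) : ell2 u -> ell2 v -> 0 <= k -> 0 <= l ->
    (forall n, Normc.normc (w n) ^+ 2 <=
       k * Normc.normc (u n) ^+ 2 + l * Normc.normc (v n) ^+ 2) ->
  ell2 w /\ nsq w <= k * nsq u + l * nsq v.
Proof.
move=> hu hv k0 l0 le; apply: nsq_finite => s us.
apply: (le_trans (ler_sum _ (fun n _ => le n))).
rewrite big_split /= -!mulr_sumr.
by apply: lerD; apply: ler_wpM2l => //; exact: nsq_ge_sum.
Qed.

Lemma nsq_scale u w (k : R) : ell2 u -> 0 <= k ->
    (forall n, Normc.normc (w n) ^+ 2 <= k * Normc.normc (u n) ^+ 2) ->
  ell2 w /\ nsq w <= k * nsq u.
Proof.
move=> hu k0 le; have := @nsq_comb u u w k 0 hu hu k0 (lexx 0).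
by rewrite mul0r addr0; apply=> n; rewrite mul0r addr0.
Qed.

Lemma sqnorm2_shift s u : sqnorm2 (sshift s u) = sqnorm2 u.
Proof.
rewrite /sqnorm2 [RHS](@reindex_esum _ _ _ setT setT (fun n => n + s)) //.
split=> //; first by move=> x y _ _ /addIr.
by move=> n _; exists (n - s) => //=; rewrite subrK.
Qed.

Lemma ell2_shift s u : ell2 u -> ell2 (sshift s u).
Proof. by rewrite /ell2 /= sqnorm2_shift. Qed.

Lemma nsq_shift s u : nsq (sshift s u) = nsq u.
Proof. by rewrite /nsq sqnorm2_shift. Qed.

Lemma sqr_normcD (x y : C) :
  Normc.normc (x + y) ^+ 2 <= 2 * Normc.normc x ^+ 2 + 2 * Normc.normc y ^+ 2.
Proof.
set a := Normc.normc x; set b := Normc.normc y.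
apply: (@le_trans _ _ ((a + b) ^+ 2)); last by have := sqr_ge0 (a - b); nra.
by rewrite lerXn2r ?nnegrE ?addr_ge0 ?normc_ge0 //; exact: le_normcD.
Qed.

Definition ell2_bdd (A : V -> V) :=
  exists2 K : R, 0 <= K & forall u, ell2 u -> ell2 (A u) /\ nsq (A u) <= K * nsq u.

Lemma bdd_comp (A B : V -> V) : ell2_bdd A -> ell2_bdd B -> ell2_bdd (A \o B).
Proof.
move=> [K K0 hA] [L L0 hB]; exists (K * L); first exact: mulr_ge0.
move=> u /hB[hBu le]; have [hABu le'] := hA _ hBu; split=> //.
by apply: le_trans le' _; rewrite -mulrA ler_wpM2l.
Qed.

Lemma bdd_add (A B : V -> V) : ell2_bdd A -> ell2_bdd B ->
  ell2_bdd (fun u n => A u n + B u n).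
Proof.
move=> [K K0 hA] [L L0 hB]; exists (2 * K + 2 * L); first by lra.
move=> u hu; have [hAu leA] := hA _ hu; have [hBu leB] := hB _ hu.
have [|h1 h2] := @nsq_comb (A u) (B u) (fun n => A u n + B u n) 2 2 hAu hBu
  ltac:(lra) ltac:(lra).
- by move=> n; exact: sqr_normcD.
- by split=> //; nra.
Qed.

Lemma bdd_mul (A : V -> V) (d : V) (M : R) :
    (forall n, Normc.normc (d n) <= M) -> ell2_bdd A ->
  ell2_bdd (fun u n => d n * A u n).
Proof.
move=> hd [K K0 hA]; have M0 : 0 <= M by apply: le_trans (hd 0); exact: normc_ge0.
exists (M ^+ 2 * K) => [|u hu]; first by rewrite mulr_ge0 // sqr_ge0.
have [hAu leA] := hA _ hu.
have [||h1 h2] := @nsq_scale (A u) (fun n => d n * A u n) (M ^+ 2) hAu.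
- exact: sqr_ge0.
- move=> n; rewrite Normc.normcM exprMn ler_wpM2r ?sqr_ge0 //.
  by rewrite lerXn2r ?nnegrE ?normc_ge0.
- by split=> //; apply: le_trans h2 _; rewrite -mulrA ler_wpM2l ?sqr_ge0.
Qed.

Lemma bdd_id : ell2_bdd id.
Proof. by exists 1 => // u hu; rewrite mul1r. Qed.

Lemma bdd_shift s : ell2_bdd (sshift s).
Proof. by exists 1 => // u hu; rewrite nsq_shift mul1r; split=> //; exact: ell2_shift. Qed.

Lemma ell2_comb (k : C) u v : ell2 u -> ell2 v -> ell2 (fun n => k * u n + v n).
Proof.
move=> hu hv.
have k0 : 0 <= 2 * Normc.normc k ^+ 2 by rewrite mulr_ge0 ?sqr_ge0.
have [|//] := @nsq_comb u v (fun n => k * u n + v n) _ 2 hu hv k0 ltac:(lra).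
by move=> n; apply: le_trans (sqr_normcD _ _) _; rewrite Normc.normcM exprMn mulrA.
Qed.

End SquareSummable.

(** * Polynomials in an operator, invertibility on l^2 *)

Section LinearMaps.
Variable R : realType.
Local Notation C := R[i].
Local Notation V := (int -> C).
Implicit Types (u v w f : V) (A B : V -> V) (p q : {poly C}).

(** Linearity is required on all sequences because it is also applied to Floquet sequences, which
    are not square-summable unless zero. *)
Definition seq_linear A :=
  forall (k : C) u v, A (fun n => k * u n + v n) = (fun n => k * A u n + A v n).

Lemma lin_zero A : seq_linear A -> A (fun=> 0) = (fun=> 0).
Proof.
move=> lA; have := lA (-1) (fun=> 0) (fun=> 0).
rewrite (_ : (fun n => _ * _ + _) = (fun=> 0)); last by apply: funext => n; rewrite mulr0 addr0.
move=> e; apply: funext => n; have := congr1 (fun x => x n) e; rewrite /= => ->.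
by rewrite mulN1r addNr.
Qed.

Definition polyop A p u : V := fun n => \sum_(i < size p) p`_i * iter i A u n.

Lemma polyop_wide A p u n m : (size p <= m)%N ->
  polyop A p u n = \sum_(i < m) p`_i * iter i A u n.
Proof.
move=> pm; rewrite /polyop (big_ord_widen _ (fun i => p`_i * iter i A u n) pm).
rewrite big_mkcond /=; apply: eq_bigr => i _.
by case: ltnP => // h; rewrite nth_default // mul0r.
Qed.

Lemma polyopD A p q u : polyop A (p + q) u = (fun n => polyop A p u n + polyop A q u n).
Proof.
apply: funext => n; pose m := maxn (size p) (size q).
rewrite !(@polyop_wide _ _ _ _ m) ?leq_maxl ?leq_maxr ?size_polyD //.
by rewrite -big_split /=; apply: eq_bigr => i _; rewrite coefD mulrDl.
Qed.

Lemma polyopZ A k p u : polyop A (k *: p) u = (fun n => k * polyop A p u n).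
Proof.
apply: funext => n; rewrite !(@polyop_wide _ _ _ _ (size p)) ?size_scale_leq //.
by rewrite mulr_sumr; apply: eq_bigr => i _; rewrite coefZ mulrA.
Qed.

Lemma polyop0 A u : polyop A 0 u = (fun=> 0).
Proof. by apply: funext => n; rewrite /polyop size_poly0 big_ord0. Qed.

Lemma polyopC A k u : polyop A k%:P u = (fun n => k * u n).
Proof.
apply: funext => n; rewrite (@polyop_wide _ _ _ _ 1) ?size_polyC_leq1 //.
by rewrite big_ord1 coefC.
Qed.

Lemma polyopMX A p u : polyop A (p * 'X) u = polyop A p (A u).
Proof.
apply: funext => n; rewrite (@polyop_wide _ _ _ _ (size p).+1); last first.
  by apply: leq_trans (size_polyMleq _ _) _; rewrite size_polyX addn2.
rewrite big_ord_recl coefMX mul0r add0r; apply: eq_bigr => i _.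
by rewrite coefMX /= -iterSr.
Qed.

Lemma polyop_cons A p k u :
  polyop A (p * 'X + k%:P) u = (fun n => polyop A p (A u) n + k * u n).
Proof. by rewrite polyopD polyopMX polyopC. Qed.

Lemma polyop_linear A p : seq_linear A -> seq_linear (polyop A p).
Proof.
move=> lA k u v; elim/poly_ind: p u v => [|p c IH] u v.
  by rewrite !polyop0; apply: funext => n; rewrite mulr0 addr0.
by rewrite !polyop_cons lA IH; apply: funext => n; ring.
Qed.

Lemma polyop_comm A B p u : seq_linear B -> (forall w, B (A w) = A (B w)) ->
  B (polyop A p u) = polyop A p (B u).
Proof.
move=> lB BA; elim/poly_ind: p u => [|p c IH] u.
  by rewrite !polyop0 lin_zero.
have -> : polyop A (p * 'X + c%:P) u = (fun n => c * u n + polyop A p (A u) n).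
  by rewrite polyop_cons; apply: funext => n; rewrite addrC.
by rewrite lB IH polyop_cons BA; apply: funext => n; rewrite addrC.
Qed.

Lemma polyopM A p q u : seq_linear A ->
  polyop A (p * q) u = polyop A p (polyop A q u).
Proof.
move=> lA; elim/poly_ind: p u => [|p c IH] u; first by rewrite mul0r !polyop0.
rewrite polyop_cons (polyop_comm _ _ lA) // -IH mulrDl polyopD mulrAC polyopMX.
by rewrite mul_polyC polyopZ.
Qed.

Lemma polyop_bdd A p : ell2_bdd A -> ell2_bdd (polyop A p).
Proof.
move=> bA; elim/poly_ind: p => [|p c IH].
  rewrite (_ : polyop A 0 = fun u n => 0); last by apply: funext => u; exact: polyop0.
  exists 0 => // u hu; have [|h] := @nsq_scale _ u (fun=> 0) 0 hu (lexx 0); last by [].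
  by move=> n; rewrite Normc.normc0 mul0r expr0n.
rewrite (_ : polyop A _ = fun u n => polyop A p (A u) n + c * u n); last first.
  by apply: funext => u; exact: polyop_cons.
apply: bdd_add; first exact: bdd_comp IH bA.
by apply: (@bdd_mul _ id _ (Normc.normc c)) => //; exact: bdd_id.
Qed.

(** The inverse is bounded by construction: the third clause bounds a preimage together with its
    existence, and such bounds multiply under composition. *)
Definition ell2_iso A := [/\ ell2_bdd A,
  forall u, ell2 u -> A u = (fun=> 0) -> u = (fun=> 0) &
  exists2 K : R, 0 <= K & forall f, ell2 f ->
    exists u, [/\ ell2 u, A u = f & nsq u <= K * nsq f]].

Lemma iso_inj A u v : seq_linear A -> ell2_iso A -> ell2 u -> ell2 v ->
  A u = A v -> u = v.
Proof.
move=> lA [_ iA _] hu hv e.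
have : (fun n => -1 * u n + v n) = (fun=> 0).
  apply: iA; first exact: ell2_comb.
  by rewrite lA e; apply: funext => n; rewrite mulN1r addNr.
move=> h; apply: funext => n; have := congr1 (fun x => x n) h.
by rewrite /= mulN1r addrC => /eqP; rewrite subr_eq0 => /eqP.
Qed.

Lemma iso_comp A B : ell2_iso A -> ell2_iso B -> ell2_iso (A \o B).
Proof.
move=> [bA iA [K K0 sA]] [bB iB [L L0 sB]]; split.
- exact: bdd_comp bA bB.
- move=> u hu /=; case: bB => M _ hB; have [hBu _] := hB _ hu; clear hB.
  by move/(iA _ hBu); exact: iB.
- exists (L * K) => [|f hf]; first exact: mulr_ge0.
  have [v [hv Av lev]] := sA _ hf; have [u [hu Bu leu]] := sB _ hv.
  exists u; split=> //=; first by rewrite Bu.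
  apply: le_trans leu _.
  by rewrite -mulrA ler_wpM2l.
Qed.

(** If A u = 0 then A (B u) = B (A u) = 0, which gives injectivity; a preimage of f under A is B
    applied to a preimage under A B. This carries invertibility from P(l) - P(J) back to l - J. *)
Lemma iso_factor A B : seq_linear B -> ell2_bdd A -> ell2_bdd B ->
  (forall u, A (B u) = B (A u)) -> ell2_iso (A \o B) -> ell2_iso A.
Proof.
move=> lB bA bB AB [_ iAB [K K0 sAB]]; split=> //.
  by move=> u hu Au; apply: iAB => //=; rewrite AB Au lin_zero.
case: bB => L L0 hB; exists (L * K) => [|f hf]; first exact: mulr_ge0.
have [u [hu ABu leu]] := sAB _ hf; have [hBu leBu] := hB _ hu.
exists (B u); split=> //; apply: le_trans leBu _.
by rewrite -mulrA ler_wpM2l.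
Qed.

Lemma iso_scale (k : C) A : k != 0 -> ell2_iso A -> ell2_iso (fun u n => k * A u n).
Proof.
move=> k0 [bA iA [K K0 sA]]; split.
- by apply: (@bdd_mul _ A (fun=> k) (Normc.normc k)).
- move=> u hu e; apply: iA => //; apply: funext => n.
  have /= /eqP := congr1 (fun x => x n) e.
  by rewrite mulf_eq0 (negPf k0) => /eqP.
- pose c := Normc.normc k^-1 ^+ 2.
  exists (K * c) => [|f hf]; first by rewrite mulr_ge0 ?sqr_ge0.
  have [n|hg leg] := @nsq_scale _ f (fun n => k^-1 * f n) c hf (sqr_ge0 _).
    by rewrite Normc.normcM exprMn.
  have [u [hu Au leu]] := sA _ hg; exists u; split=> //.
    by rewrite Au; apply: funext => n; rewrite mulVKf.
  by apply: le_trans leu _; rewrite -mulrA ler_wpM2l.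
Qed.

Lemma iso_resolvent T (l : C) :
    seq_linear T -> ell2_iso (fun u n => l * u n - T u n) ->
  resolvent_set T l.
Proof.
move=> lT; set A := fun u n => _ => isoA.
have lA : seq_linear A.
  by move=> k u v; rewrite /A lT; apply: funext => n; ring.
have [_ iA [K K0 sA]] := isoA.
(* Outside [ell2] the chosen inverse is unconstrained, and [bounded_operator] asks nothing there; on
   [ell2] its linearity follows from the injectivity of A. *)
have /choice[S SP] : forall f, exists u, ell2 f ->
    [/\ ell2 u, A u = f & nsq u <= K * nsq f].
  move=> f; have [hf|nf] := pselect (ell2 f); last by exists f.
  by have [u uP] := sA _ hf; exists u.
exists S; split; last first.
  move=> u hu; have hAu : ell2 (A u) by case: isoA => -[L _ hA] _ _; case: (hA u hu).
  split; last by case: (SP u hu).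
  by have [h1 h2 _] := SP _ hAu; exact: (@iso_inj A).
split=> [u /SP[]//|k u v hu hv|].
  have [hSu ASu _] := SP _ hu; have [hSv ASv _] := SP _ hv.
  have [hSw ASw _] := SP _ (ell2_comb k hu hv).
  apply: (@iso_inj A) => //; first exact: ell2_comb.
  by rewrite ASw lA ASu ASv.
exists (Num.sqrt K) => u hu; have [_ _ le] := SP _ hu.
by rewrite /norm2 -sqrtrM // ler_wsqrtr.
Qed.

End LinearMaps.

(** * Polynomials in a shift *)

Section ComplexLimits.
Variable R : realType.
Local Notation C := R[i].
Implicit Types (x y : nat -> C) (l m : C).

(* Componentwise, as R[i] has no complete normed structure to take limits in. *)
Definition ccvg x l :=
  (complex.Re (x n) @[n --> \oo] --> complex.Re l) /\
  (complex.Im (x n) @[n --> \oo] --> complex.Im l).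

Lemma ccvg_unique x l m : ccvg x l -> ccvg x m -> l = m.
Proof.
move=> [h1 h2] [h3 h4]; apply/eqP; rewrite eq_complex; apply/andP; split.
  by apply/eqP; apply: (cvg_unique _ h1 h3).
by apply/eqP; apply: (cvg_unique _ h2 h4).
Qed.

Lemma ccvgMD x l (a z : C) : ccvg x l -> ccvg (fun n => a + z * x n) (a + z * l).
Proof.
case: a z l => a1 a2 [z1 z2] [l1 l2] [h1 h2]; split=> /=.
  rewrite [X in X @ _ --> _](_ : _ = (fun n => a1 +
    (z1 * complex.Re (x n) - z2 * complex.Im (x n)))).
    by apply: cvgD; [exact: cvg_cst|apply: cvgB; apply: cvgMr].
  by apply: funext => n; case: (x n).
rewrite [X in X @ _ --> _](_ : _ = (fun n => a2 +
  (z1 * complex.Im (x n) + z2 * complex.Re (x n)))).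
  by apply: cvgD; [exact: cvg_cst|apply: cvgD; apply: cvgMr].
by apply: funext => n; case: (x n).
Qed.

Lemma ccvg_shift x l : ccvg x l -> ccvg (fun n => x n.+1) l.
Proof.
move=> [h1 h2]; split.
  by move: h1; rewrite -(cvg_shiftS (fun n => complex.Re (x n))).
by move: h2; rewrite -(cvg_shiftS (fun n => complex.Im (x n))).
Qed.

Lemma normc2E (z : C) : Normc.normc z ^+ 2 = complex.Re z ^+ 2 + complex.Im z ^+ 2.
Proof. by case: z => a b /=; rewrite sqr_sqrtr // addr_ge0 ?sqr_ge0. Qed.

(** A form of Fatou's lemma for finite sums: a bound uniform in n survives the pointwise limit, and
    [nsq_finite] then turns it into an l^2 bound. *)
Lemma ccvg_sum_le (I : Type) (s : seq I) (x : nat -> I -> C) (l : I -> C) (B : R) :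
    (forall i, ccvg (x^~ i) (l i)) ->
    (forall n, \sum_(i <- s) Normc.normc (x n i) ^+ 2 <= B) ->
  \sum_(i <- s) Normc.normc (l i) ^+ 2 <= B.
Proof.
move=> xl xB; suff h : \sum_(i <- s) Normc.normc (x n i) ^+ 2 @[n --> \oo] -->
    \sum_(i <- s) Normc.normc (l i) ^+ 2.
  by apply: (cvgr_to_le h); apply: nearW.
elim: s {xB} => [|i s IH].
  by under eq_cvg do rewrite big_nil; rewrite big_nil; exact: cvg_cst.
under eq_cvg do rewrite big_cons normc2E; rewrite big_cons normc2E.
have [h1 h2] := xl i; apply: cvgD => //.
by apply: cvgD; under eq_cvg do rewrite expr2; rewrite expr2; apply: cvgM.
Qed.

Lemma ccvg_series (t : nat -> C) (B q : R) : 0 <= q < 1 ->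
    (forall k, Normc.normc (t k) <= B * q ^+ k) ->
  exists l, ccvg (fun n => \sum_(0 <= k < n) t k) l.
Proof.
move=> q01 tB.
have cv (x : nat -> R) : (forall k, `|x k| <= B * q ^+ k) -> cvgn (series x).
  move=> xB; apply: normed_cvg.
  apply: (@series_le_cvg _ _ (geometric B q)) => //.
  - by move=> n; exact: normr_ge0.
  - by move=> n; exact: le_trans (normr_ge0 (x n)) (xB n).
  - apply: is_cvg_geometric_series; rewrite ger0_norm; lra.
have reB k : `|complex.Re (t k)| <= B * q ^+ k.
  apply: le_trans (tB k); rewrite -ler_sqr ?nnegrE ?normc_ge0 //.
  by rewrite normc2E real_normK ?num_real // lerDl sqr_ge0.
have imB k : `|complex.Im (t k)| <= B * q ^+ k.
  apply: le_trans (tB k); rewrite -ler_sqr ?nnegrE ?normc_ge0 //.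
  by rewrite normc2E real_normK ?num_real // lerDr sqr_ge0.
have ReE n : complex.Re (\sum_(0 <= k < n) t k) = series (fun k => complex.Re (t k)) n.
  rewrite /series /=; elim: n => [|n IH]; first by rewrite !big_nil.
  by rewrite !big_nat_recr //= -IH; case: (\sum_(0 <= _ < _) _); case: (t n).
have ImE n : complex.Im (\sum_(0 <= k < n) t k) = series (fun k => complex.Im (t k)) n.
  rewrite /series /=; elim: n => [|n IH]; first by rewrite !big_nil.
  by rewrite !big_nat_recr //= -IH; case: (\sum_(0 <= _ < _) _); case: (t n).
exists (lim (series (fun k => complex.Re (t k)) @ \oo)
       +i* lim (series (fun k => complex.Im (t k)) @ \oo)); split => /=.
  by under eq_cvg do rewrite ReE; exact: cv.
by under eq_cvg do rewrite ImE; exact: cv.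
Qed.

End ComplexLimits.

(** * Inverting T - z for z off the unit circle *)

Section Neumann.
Variable R : realType.
Local Notation C := R[i].
Local Notation V := (int -> C).
Implicit Types (u v w f : V).

(** Convexity of the square with weights 1 - q and q, applied to |x| / (1 - q) and |y|. The
    coefficient q < 1 of the second term makes the recursion on Neumann sums contract, which the
    factor 2 of [sqr_normcD] would not do for q near 1. *)
Lemma sqr_normc_convex (x y z : C) (q : R) : q = Normc.normc z -> q < 1 ->
  Normc.normc (x + z * y) ^+ 2 <=
    (1 - q)^-1 * Normc.normc x ^+ 2 + q * Normc.normc y ^+ 2.
Proof.
move=> qz q1; have q0 : 0 <= q by rewrite qz normc_ge0.
have := normc_ge0 x; have := normc_ge0 y.
have : Normc.normc (x + z * y) <= Normc.normc x + q * Normc.normc y.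
  by rewrite qz -Normc.normcM; exact: le_normcD.
have := normc_ge0 (x + z * y).
move: (Normc.normc x) (Normc.normc y) (Normc.normc _) => a b c c0 cab b0 a0.
apply: (@le_trans _ _ ((a + q * b) ^+ 2)).
  by rewrite lerXn2r ?nnegrE // addr_ge0 // mulr_ge0.
rewrite -subr_ge0.
have -> : (1 - q)^-1 * a ^+ 2 + q * b ^+ 2 - (a + q * b) ^+ 2 =
    (1 - q)^-1 * (q * (a - (1 - q) * b) ^+ 2) by field; rewrite gt_eqF // subr_gt0.
apply: mulr_ge0; first by rewrite invr_ge0 subr_ge0 ltW.
by rewrite mulr_ge0 ?sqr_ge0.
Qed.

(** With S the shift by [s], the inverse is the sum of z^k S^k, taken entry by entry: geometric
    domination gives each limit, and the uniform bound on the partial sums [g M] passes to it. *)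
Lemma iso_neumann (s : int) (z : C) : Normc.normc z < 1 ->
  ell2_iso (fun (u : V) n => u n - z * sshift s u n).
Proof.
move=> z1; have z0 := normc_ge0 z; set q := Normc.normc z in z0 z1 *.
have q1 : 0 < 1 - q by lra.
split.
- have -> : (fun (u : V) n => u n - z * sshift s u n) = (fun (u : V) n => u n + (- z) * sshift s u n).
    by apply: funext => u; apply: funext => n; rewrite mulNr.
  apply: bdd_add; first exact: bdd_id.
  by apply: (@bdd_mul _ (sshift s) (fun=> - z) (Normc.normc (- z))) => //; exact: bdd_shift.
- move=> u hu e; apply: nsq_eq0 => //.
  have [n|_ le] := @nsq_scale _ (sshift s u) u (q ^+ 2) (ell2_shift s hu) (sqr_ge0 _).
    have /= /eqP := congr1 (fun x => x n) e; rewrite subr_eq0 => /eqP {1}->.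
    by rewrite Normc.normcM exprMn.
  rewrite nsq_shift in le; have q2 : 0 < 1 - q ^+ 2 by nra.
  by rewrite -(pmulr_rle0 _ q2); lra.
(* The constant is the fixed point of K -> (1 - q)^-1 + q K, the recursion that [sqr_normc_convex]
   gives for the partial sums. *)
exists ((1 - q)^-1 * (1 - q)^-1) => [|f hf]; first by rewrite mulr_ge0 // invr_ge0 ltW.
pose g (M : nat) n := \sum_(0 <= k < M) z ^+ k * f (n + s *+ k).
have gS M n : g M.+1 n = f n + z * g M (n + s).
  rewrite /g big_nat_recl // expr0 mul1r mulr0n addr0; congr (_ + _).
  rewrite mulr_sumr; apply: eq_bigr => k _.
  by rewrite mulrA -exprS mulrS addrA.
have gB M : ell2 (g M) /\ nsq (g M) <= (1 - q)^-1 * (1 - q)^-1 * nsq f.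
  elim: M => [|M [hg leg]].
    have g0 : g 0%N = (fun n => 0 * f n).
      by apply: funext => n; rewrite /g big_nil mul0r.
    have [n|h1 h2] := @nsq_scale _ f (g 0%N) 0 hf (lexx 0).
      by rewrite g0 !mul0r Normc.normc0 expr0n.
    split=> //; apply: le_trans h2 _; rewrite mul0r.
    by rewrite !mulr_ge0 ?invr_ge0 ?nsq_ge0 // ltW.
  have iq0 : 0 <= (1 - q)^-1 by rewrite invr_ge0 ltW.
  have [n|h1 h2] := @nsq_comb _ f (sshift s (g M)) (g M.+1) (1 - q)^-1 q
      hf (ell2_shift s hg) iq0 z0.
    by rewrite gS; apply: sqr_normc_convex.
  split=> //; apply: le_trans h2 _; rewrite nsq_shift.
  have := ler_wpM2l z0 leg; set F := nsq f.
  have -> : (1 - q)^-1 * F + q * nsq (g M) =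
            q * nsq (g M) + (1 - q)^-1 * F by rewrite addrC.
  move=> le; apply: (le_trans (lerD le (lexx _))).
  by rewrite le_eqVlt; apply/orP; left; apply/eqP; field; rewrite gt_eqF.
have fB n : Normc.normc (f n) <= Num.sqrt (nsq f).
  rewrite -(ger0_norm (normc_ge0 _)) -sqrtr_sqr ler_wsqrtr //.
  exact: normc_le_nsq.
have /choice[h hP] n : exists l, ccvg (fun M => g M n) l.
  apply: (@ccvg_series _ _ (Num.sqrt (nsq f)) q); first by rewrite z0.
  move=> k; rewrite Normc.normcM normcX mulrC ler_wpM2r ?exprn_ge0 //.
have [hh leh] : ell2 h /\ nsq h <= (1 - q)^-1 * (1 - q)^-1 * nsq f.
  apply: nsq_finite => r ur; apply: (ccvg_sum_le (x := g)) => // M.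
  by have [hg leg] := gB M; apply: le_trans leg; exact: nsq_ge_sum.
exists h; split=> //; apply: funext => n; rewrite /sshift.
have -> : h n = f n + z * h (n + s); last by rewrite addrK.
apply: (ccvg_unique (ccvg_shift (hP n))).
rewrite (_ : (fun M => g M.+1 n) = (fun M => f n + z * g M (n + s))).
  exact: ccvgMD.
by apply: funext => M; exact: gS.
Qed.

Lemma iso_shift (s : int) : ell2_iso (@sshift R s).
Proof.
split; first exact: bdd_shift.
- move=> u hu e; apply: funext => n; have := congr1 (fun x => x (n - s)) e.
  by rewrite /sshift /= subrK.
- exists 1 => // f hf; exists (sshift (- s) f).
  rewrite nsq_shift mul1r; split=> //; first exact: ell2_shift.
  by apply: funext => n; rewrite /sshift addrK.
Qed.

Lemma shift_linear (s : int) : seq_linear (@sshift R s).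
Proof. by []. Qed.

(** With S the shift by [s]: S - z = S (1 - z S^-1) when |z| < 1, and S - z = -z (1 - z^-1 S) when
    |z| > 1. *)
Lemma iso_shift_sub (s : int) (z : C) : Normc.normc z != 1 ->
  ell2_iso (fun (u : V) n => sshift s u n - z * u n).
Proof.
move=> zn1; have [z1|z1|z1] := ltgtP (Normc.normc z) 1; last by rewrite z1 eqxx in zn1.
  have := iso_comp (iso_shift s) (iso_neumann (- s) z1).
  by congr ell2_iso; apply: funext => u; apply: funext => n; rewrite /= /sshift addrK.
have z0 : z != 0.
  by apply: contraTneq z1 => ->; rewrite Normc.normc0 -leNgt ler01.
have iz1 : Normc.normc z^-1 < 1 by rewrite Normc.normcV invf_lt1 // (lt_trans _ z1).
have nz0 : - z != 0 by rewrite oppr_eq0.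
have := iso_scale nz0 (iso_neumann s iz1).
by congr ell2_iso; apply: funext => u; apply: funext => n; rewrite /sshift; field.
Qed.

Lemma iso_polyop_shift (s : int) (p : {poly C}) : p != 0 ->
    (forall z, root p z -> Normc.normc z != 1) ->
  ell2_iso (polyop (@sshift R s) p).
Proof.
move=> p0; have [r pr] := closed_field_poly_normal p.
have lc0 : lead_coef p != 0 by rewrite lead_coef_eq0.
rewrite pr => rootr.
have {rootr} : forall z, z \in r -> Normc.normc z != 1.
  by move=> z zr; apply: rootr; rewrite rootZ // root_prod_XsubC.
move=> {pr p0}; move: (lead_coef p) lc0 => k k0.
have -> : polyop (@sshift R s) (k *: \prod_(z <- r) ('X - z%:P)) =
    (fun u n => k * polyop (@sshift R s) (\prod_(z <- r) ('X - z%:P)) u n).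
  by apply: funext => u; exact: polyopZ.
move=> hr; apply: iso_scale => //; elim: r hr => [|z r IH] hr.
  rewrite big_nil; have := iso_shift 0; congr ell2_iso; apply: funext => u.
  by rewrite polyopC; apply: funext => n; rewrite /sshift addr0 mul1r.
rewrite big_cons; have zr : Normc.normc z != 1 by apply: hr; rewrite mem_head.
have zr' x : x \in r -> Normc.normc x != 1.
  by move=> xr; apply: hr; rewrite in_cons xr orbT.
have := iso_comp (iso_shift_sub s zr) (IH zr').
congr ell2_iso; apply: funext => u; rewrite polyopM; last exact: shift_linear.
rewrite /= [RHS](_ : _ = polyop (@sshift R s) (1 * 'X + (- z)%:P)
  (polyop (@sshift R s) (\prod_(z <- r) ('X - z%:P)) u)).
  by rewrite polyop_cons polyopC; apply: funext => n; rewrite mul1r mulNr.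
by rewrite mul1r rmorphN.
Qed.

End Neumann.

(** * The formula P(J) = a T + c T^-1 *)

Section Periodicity.
Variable N : nat.
Hypothesis N0 : (0 < N)%N.

(** The representatives are 1, ..., N rather than 0, ..., N - 1, to match the rows of [Jmx]; the
    equivalence lets the property travel both ways. *)
Lemma int_mod_ind (P : int -> Prop) :
    (forall n, P n <-> P (n + N%:Z)) -> (forall i, (i < N)%N -> P i.+1%:Z) ->
  forall n, P n.
Proof.
move=> PN P1 n.
have Nz : (N%:Z != 0) by rewrite -lt0n.
have Pk (m : int) (k : nat) : P m <-> P (m + (k * N)%N%:Z).
  elim: k => [|k IH]; first by rewrite mul0n addr0.
  by rewrite IH PN mulSn PoszD addrA addrAC.
have [r rN nr] : exists2 r : nat, (r < N)%N & exists k : nat,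
    n = r.+1%:Z + (k * N)%N%:Z \/ r.+1%:Z = n + (k * N)%N%:Z.
  have e := divz_eq (n - 1) N; have r0 := modz_ge0 (n - 1) Nz.
  have rN : ((n - 1) %% N)%Z < N%:Z by exact: ltz_mod.
  exists `|((n - 1) %% N)%Z|%N; first by rewrite -ltz_nat gez0_abs.
  move: (gez0_abs r0) e; move: ((n - 1) %% N)%Z => r {rN}<-.
  by case: ((n - 1) %/ N)%Z => k e; [exists k; left; lia|exists k.+1; right; lia].
case: nr => k [->|e]; first by rewrite -Pk; exact: P1.
by rewrite (Pk _ k) -e; exact: P1.
Qed.

End Periodicity.

Section Magic.
Variables (R : realType) (a b c : int -> R[i]) (N' : nat).
Let N := N'.+1.
Local Notation C := R[i].
Local Notation V := (int -> C).
Hypotheses (ha : seq_periodic N a) (hb : seq_periodic N b) (hc : seq_periodic N c).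
Implicit Types u v : V.
Local Notation J := (jacobi a b c).
Local Notation P := (discriminant a b c N).
Local Notation T := (@sshift R N%:Z).
Local Notation T' := (@sshift R (- N%:Z)).

Lemma periodic_bounded (d : V) : seq_periodic N d ->
  exists M : R, forall n, Normc.normc (d n) <= M.
Proof.
move=> hd; exists (\sum_(i < N) Normc.normc (d i.+1%:Z)).
apply: (@int_mod_ind N) => // [n|i iN]; first by rewrite hd.
rewrite (bigD1 (Ordinal iN)) //= lerDl.
by apply: sumr_ge0 => j _; exact: normc_ge0.
Qed.

Lemma jacobi_linear : seq_linear J.
Proof. by move=> k u v; apply: funext => n; rewrite /jacobi; ring. Qed.

Lemma jacobi_shift u : T (J u) = J (T u).
Proof.
apply: funext => n; rewrite /sshift /jacobi ha hb.
have -> : n + N%:Z - 1 = n - 1 + N%:Z by ring.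
have -> : n + N%:Z + 1 = n + 1 + N%:Z by ring.
by rewrite hc.
Qed.

Lemma jacobi_bdd : ell2_bdd J.
Proof.
have [Ma hMa] := periodic_bounded ha; have [Mb hMb] := periodic_bounded hb.
have [Mc hMc] := periodic_bounded hc.
have -> : J = fun u n => (fun u n => a n * sshift 1 u n + b n * u n) u n
                         + c (n - 1) * sshift (-1) u n by [].
apply: bdd_add; last first.
  by apply: (@bdd_mul _ (sshift (-1)) (fun n => c (n - 1)) Mc) => //; exact: bdd_shift.
apply: bdd_add; first by apply: (@bdd_mul _ (sshift 1) a Ma) => //; exact: bdd_shift.
by apply: (@bdd_mul _ id b Mb) => //; exact: bdd_id.
Qed.

Definition floquet (w : C) u := forall n, u (n + N%:Z) = w * u n.

Lemma floquet_jacobi w u : floquet w u -> floquet w (J u).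
Proof.
move=> fu n; rewrite -[LHS]/(T (J u) n) jacobi_shift.
have -> : T u = (fun n => w * u n + (fun=> 0) n) by apply: funext => m; rewrite addr0 -fu.
by rewrite jacobi_linear lin_zero ?addr0 //; exact: jacobi_linear.
Qed.

Lemma floquet_polyop w p u : floquet w u -> floquet w (polyop J p u).
Proof.
elim/poly_ind: p u => [|p k IH] u fu n; first by rewrite polyop0 mulr0.
by rewrite polyop_cons fu IH; [ring | exact: floquet_jacobi].
Qed.

Definition period_vec u : 'cV[C]_N := \col_i u i.+1%:Z.

Lemma sum_ord_eq (q : bool) (k : nat) (x : nat -> C) :
  \sum_(j < N) (if q && (j == k :> nat) then x j else 0) =
  if q && (k < N)%N then x k else 0.
Proof.
case: q => /=; last by rewrite big1.
rewrite -big_mkcond; case: ltnP => kN; last first.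
  by rewrite big_pred0 // => j; rewrite ltn_eqF // (leq_trans (ltn_ord j)).
by rewrite (big_pred1 (Ordinal kN)).
Qed.

(** The multiplier is e^(-it) because u_(N+1) = e^(-it) u_1 must produce the corner a_N e^(-it) in
    row N; likewise u_0 = e^(it) u_N produces c_N e^(it) in row 1. *)
Lemma period_vec_jacobi (t : R) u : floquet (expi (- t)) u ->
  period_vec (J u) = Jmx a b c N t *m period_vec u.
Proof.
move=> fu; apply/matrixP => i k; rewrite ord1 {k} !mxE.
pose x (j : nat) := u j.+1%:Z.
pose S (q : bool) (k : nat) (f : nat -> C) :=
  \sum_(j < N) (if q && (j == k :> nat) then f j else 0).
have SE q k f : S q k f = if q && (k < N)%N then f k else 0 by exact: sum_ord_eq.
(* One sum for each family of matrix entries. Adding them, rather than choosing between positions,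
   covers N = 1 and N = 2, where the corners fall on other entries. *)
transitivity (S true i (fun j => b i.+1%:Z * x j)
  + S true i.+1 (fun j => a i.+1%:Z * x j)
  + S (i != 0%N :> nat) i.-1 (fun j => c j.+1%:Z * x j)
  + S (i == 0%N :> nat) N' (fun j => expi t * c N%:Z * x j)
  + S (i == N' :> nat) 0%N (fun j => expi (- t) * a N%:Z * x j)).
  rewrite !SE ltn_ord ltnS leqnn /= andbT /jacobi.
  have iN := ltn_ord i; rewrite -!addrA; move: (i : nat) iN => {i} i iN.
  have wE : expi t * expi (- t) = 1 :> C by rewrite mulrC expiN.
  have Ea : a i.+1%:Z * u (i.+1%:Z + 1) =
      (if (i.+1 < N)%N then a i.+1%:Z * x i.+1 else 0) +
      (if i == N' then expi (- t) * a N%:Z * x 0%N else 0).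
    have [->|iN'] := eqVneq i N'.
      rewrite ltnn add0r /x -mulrA mulrCA -fu; congr (_ * u _); rewrite /N; lia.
    have -> : (i.+1 < N)%N by rewrite /N in iN *; lia.
    by rewrite addr0 /x; congr (_ * u _); lia.
  have Ec : c (i.+1%:Z - 1) * u (i.+1%:Z - 1) =
      (if (i != 0%N) && (i.-1 < N)%N then c i.-1.+1%:Z * x i.-1 else 0) +
      (if i == 0%N then expi t * c N%:Z * x N' else 0).
    have [->|i0] := eqVneq i 0%N.
      have -> : 1 - 1 = 0 :> int by [].
      rewrite add0r /x -/N; have := fu 0; have := hc 0; rewrite add0r => -> ->.
      by rewrite mulrACA wE mul1r.
    have -> : (i.-1 < N)%N by rewrite (leq_ltn_trans (leq_pred _)).
    by rewrite addr0 /x /= prednK ?lt0n //; congr (c _ * u _); lia.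
  rewrite Ea Ec /x.
  have -> : (i.+1 < N)%N = (i < N')%N by [].
  rewrite addrCA -!addrA; congr (_ + (_ + _)).
  by rewrite addrC -addrA (_ : (0 < N)%N = true) // andbT.
rewrite /S -!big_split /=; apply: eq_bigr => j _; rewrite /x !mxE -/N !eqSS.
case: (i : nat) => {i} [|i] /=.
  case: (j : nat) => [|[|k]] /=; case: N' => [|[|n]] /=; rewrite ?eqSS;
    try case: ifP => _; ring.
rewrite ?eqSS; have -> : (i == j :> nat) = (j == i :> nat) by rewrite eq_sym.
have [->|j1] := eqVneq (j : nat) i.+1.
  have -> : (i.+1 == i.+2) = false by lia.
  have -> : (i.+1 == i) = false by lia.
  by rewrite andbF; ring.
have [->|j2] := eqVneq (j : nat) i.+2.
  have -> : (i.+2 == i) = false by lia.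
  by rewrite andbF; ring.
by case: ifP => _; case: ifP => _; ring.
Qed.

Lemma period_vec_inj w u v : floquet w u -> floquet w v -> w != 0 ->
  period_vec u = period_vec v -> u = v.
Proof.
move=> fu fv w0 e; apply: funext; apply: (@int_mod_ind N) => // [n|i iN].
  by rewrite fu fv; split=> [->|/(mulfI w0)].
by have /matrixP/(_ (Ordinal iN) 0) := e; rewrite !mxE.
Qed.

Lemma period_vec_polyop (t : R) p u : floquet (expi (- t)) u ->
  period_vec (polyop J p u) = horner_mx (Jmx a b c N t) p *m period_vec u.
Proof.
elim/poly_ind: p u => [|p k IH] u fu.
  by rewrite polyop0 rmorph0 mul0mx; apply/matrixP => i j; rewrite !mxE.
rewrite rmorphD rmorphM /= horner_mx_X horner_mx_C mulmxDl -mulmxA.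
rewrite -period_vec_jacobi // -IH; last exact: floquet_jacobi.
rewrite polyop_cons mul_scalar_mx.
by apply/matrixP => i j; rewrite !mxE.
Qed.

Definition magic u := polyop J P u =
  (fun n => period_prod N a * T u n + period_prod N c * T' u n).

(** The characteristic polynomial of the Floquet matrix is P minus a e^(-it) + c e^(it), so P of
    this matrix is that scalar; on the sequence, T and its inverse act as e^(-it) and e^(it). *)
Lemma magic_floquet (t : R) u : floquet (expi (- t)) u -> magic u.
Proof.
move=> fu; have w0 : expi (- t) != 0 :> C by rewrite circle_neq0 // expi_circle.
have fT' n : T' u n = expi t * u n.
  have := fu (n - N%:Z); rewrite subrK /sshift => ->.
  by rewrite mulrA [expi t * _]mulrC expiN mul1r.
apply: (period_vec_inj (w := expi (- t))) => //; first exact: floquet_polyop.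
  by move=> n; rewrite !fT' /sshift !fu; ring.
rewrite (@period_vec_polyop t) //.
have := char_poly_Jmx a b c (ltn0Sn N') t; rewrite -/N.
move=> /(congr1 (fun q => q + (period_prod N a * expi (- t) +
                               period_prod N c * expi t)%:P)).
rewrite subrK => <-; rewrite rmorphD /= horner_mx_C Cayley_Hamilton add0r.
rewrite mul_scalar_mx; apply/matrixP => i j; rewrite !mxE.
by rewrite fT' /sshift fu; ring.
Qed.

Lemma magic_comb (k : C) u v : magic u -> magic v -> magic (fun n => k * u n + v n).
Proof.
move=> mu mv; rewrite /magic polyop_linear ?mu ?mv; last exact: jacobi_linear.
by apply: funext => n; rewrite /sshift; ring.
Qed.

Lemma polyop_local (p : {poly C}) u v n :
    (forall m : int, n - (size p)%:Z < m < n + (size p)%:Z -> u m = v m) ->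
  polyop J p u n = polyop J p v n.
Proof.
move=> uv; rewrite /polyop; apply: eq_bigr => -[i ip] _ /=; congr (_ * _).
have: forall m : int, n - i%:Z <= m <= n + i%:Z -> u m = v m.
  by move=> m hm; apply: uv; lia.
elim: i n {ip uv} => [|i IH] n uv /=; first by apply: uv; lia.
by rewrite /jacobi !IH // => m hm; apply: uv; lia.
Qed.

Lemma expi_pi2 : expi (pi / 2) = 'i%C :> C.
Proof. by rewrite /expi cos_pihalf sin_pihalf. Qed.

(* A sequence of period 4N is the sum of four Floquet sequences, with multipliers
   the fourth roots of unity. *)
Lemma magic_periodic u : (forall n, u (n + (4 * N)%N%:Z) = u n) -> magic u.
Proof.
move=> u4; pose I : C := 'i%C.
have I2 : I * I = -1 by rewrite -expr2 sqr_i.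
(* Four times the component of [u] with multiplier [w]: when w^4 = 1, written below as
   [w^-1 ^+ 3 = w], a shift by N permutes the four terms cyclically up to the factor w. *)
pose U (w : C) n := u n + w^-1 * T u n + w^-1 ^+ 2 * T (T u) n + w^-1 ^+ 3 * T (T (T u)) n.
have fU w : w != 0 -> w^-1 ^+ 3 = w -> floquet w (U w).
  move=> w0 w3 n; rewrite /U /sshift.
  have -> : u (n + N%:Z + N%:Z + N%:Z + N%:Z) = u n by rewrite -(u4 n); congr u; lia.
  rewrite w3; move: (u _) (u _) (u _) (u _) => x y z y'.
  have vw : w * w^-1 = 1 by rewrite mulfV.
  have ww : w * w = w^-1 ^+ 2 by rewrite -{2}w3 exprS mulrA vw mul1r.
  transitivity (w * x + (w * w^-1) * y' + (w * w^-1) * w^-1 * z + (w * w) * y).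
    by rewrite vw ww; move: (w^-1) => s; ring.
  by move: (w^-1) => s; ring.
have mU t (w : C) : expi t = w -> w ^+ 3 = w^-1 -> magic (U w^-1).
  move=> tw w3; have w0 : w != 0 by rewrite -tw circle_neq0 // expi_circle.
  apply: (@magic_floquet t); rewrite expiV tw.
  by apply: fU; rewrite ?invr_eq0 // invrK.
have I0 : I != 0.
  by apply: contra_eq_neq I2 => ->; rewrite mul0r eq_sym oppr_eq0 oner_eq0.
have I1 : I^-1 = - I by apply: (mulfI I0); rewrite mulfV // mulrN I2 opprK.
have m1 : magic (U 1).
  by rewrite -invr1; apply: (mU 0); rewrite ?expi0 // expr1n invr1.
have m2 : magic (U (- I)).
  rewrite -I1; apply: (mU (pi / 2)); rewrite ?expi_pi2 //.
  by rewrite I1 exprS expr2 I2 mulrN1.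
have m3 : magic (U (-1)).
  rewrite -[-1]invrK invrN1; apply: (mU pi); first by rewrite /expi cospi sinpi complexr0 rmorphN rmorph1.
  by rewrite invrN1 exprS expr2 mulrNN !mulr1.
have m4 : magic (U I).
  rewrite -[I]invrK I1; apply: (mU (- (pi / 2))).
    by rewrite expiV expi_pi2 I1.
  by rewrite invrN I1 opprK exprS expr2 mulrNN I2 mulrN1 opprK.
have m0 : magic (fun=> 0).
  rewrite /magic lin_zero; last exact: polyop_linear jacobi_linear.
  by apply: funext => n; rewrite /sshift; ring.
have -> : u = (fun n => 4^-1 * U 1 n + (4^-1 * U (- I) n +
    (4^-1 * U (-1) n + (4^-1 * U I n + 0)))).
  apply: funext => n; rewrite /U invr1 invrN I1 invrN1 opprK.
  move: (u n) (T u n) (T (T u) n) (T (T (T u)) n) => x y z y'.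
  transitivity (x + (1 + I * I) / 2 * z); first by rewrite I2 subrr mul0r mul0r addr0.
  by move: I {I2 I0 I1 m2 m4} => i; field.
by do 4!apply: (@magic_comb 4^-1) => //.
Qed.

(** Both sides at n involve only u at n - N, ..., n + N. The window of 4N positions starting at n -
    2N contains these, and its periodic repetition [v] is covered by [magic_periodic]. *)
Theorem magic_formula u : polyop J P u =
  (fun n => period_prod N a * u (n + N%:Z) + period_prod N c * u (n - N%:Z)).
Proof.
apply: funext => n; pose m0 := n - (2 * N)%N%:Z.
pose v m := u (m0 + ((m - m0) %% (4 * N)%N)%Z).
have vu m : m0 <= m < m0 + (4 * N)%N%:Z -> v m = u m.
  move=> hm; rewrite /v modz_small; first by congr u; ring.
  by lia.
have v4 m : v (m + (4 * N)%N%:Z) = v m.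
  by rewrite /v; congr (u (_ + _)); rewrite addrAC modzDr.
have mv := magic_periodic v4.
have -> : polyop J P u n = polyop J P v n.
  apply: polyop_local => m; rewrite (discriminant_lead a b c (ltn0Sn N')).1 => hm.
  by rewrite vu // /m0 /N; lia.
rewrite mv /sshift !vu // /m0 /N; lia.
Qed.
End Magic.

(** * The spectrum of J *)

Section Spectrum.
Variables (R : realType) (a b c : int -> R[i]) (N' : nat).
Let N := N'.+1.
Local Notation C := R[i].
Local Notation V := (int -> C).
Hypotheses (ha : seq_periodic N a) (hb : seq_periodic N b) (hc : seq_periodic N c).
Implicit Types u v : V.
Local Notation J := (jacobi a b c).
Local Notation P := (discriminant a b c N).
Local Notation pa := (period_prod N a).
Local Notation pc := (period_prod N c).

Lemma resolvent_of_discriminant (l : C) : ~ (pa = 0 /\ pc = 0) ->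
  ~ Eset a c N P.[l] -> resolvent_set J l.
Proof.
move=> hac nE; apply: iso_resolvent; first exact: jacobi_linear.
have /factor_theorem[Q PQ] : root (P - P.[l]%:P) l.
  by rewrite rootE hornerD hornerN hornerC subrr.
have bJ : ell2_bdd J by exact: jacobi_bdd ha hb hc.
have lJ : seq_linear J by exact: jacobi_linear.
have lA : seq_linear (fun u n => l * u n - J u n).
  by move=> k u v; rewrite lJ; apply: funext => n; ring.
have lXE u : polyop J ('X - l%:P) u = (fun n => J u n - l * u n).
  have -> : 'X - l%:P = 1 * 'X + (- l)%:P by rewrite mul1r rmorphN.
  by rewrite polyop_cons polyopC; apply: funext => n; ring.
apply: (@iso_factor _ _ (polyop J Q)).
- exact: polyop_linear.
- have -> : (fun (u : V) n => l * u n - J u n) =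
      (fun u n => (fun _ : int => l) n * u n + -1 * J u n).
    by apply: funext => u; apply: funext => n; ring.
  apply: bdd_add.
    by apply: (@bdd_mul _ id (fun=> l) (Normc.normc l)) => //; exact: bdd_id.
  by apply: (@bdd_mul _ J (fun=> -1) (Normc.normc (-1))).
- exact: polyop_bdd.
- move=> u; apply: (@polyop_comm _ J (fun u n => l * u n - J u n)) => // w.
  by apply: funext => n; rewrite /jacobi; ring.
(* f(T) = T (P(l) - a T - c T^-1), with T the shift by N, has only nonnegative powers. Since P -
   P(l) = Q (X - l), [magic_formula] gives (l - J) Q(J) = T^-1 f(T). *)
pose f : {poly C} := ((- pa)%:P * 'X + P.[l]%:P) * 'X + (- pc)%:P.
have fE u : polyop (@sshift R N%:Z) f u =
    (fun n => - pa * u (n + N%:Z + N%:Z) + P.[l] * u (n + N%:Z) - pc * u n).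
  by rewrite !polyop_cons polyopC; apply: funext => n; rewrite /sshift; ring.
have isof : ell2_iso (polyop (@sshift R N%:Z) f).
  apply: iso_polyop_shift => [|z].
    apply/eqP => f0; apply: hac; split.
      by have := congr1 (fun q : {poly C} => q`_2) f0;
        rewrite !(coefD, coefMX, coefC) /= !addr0 => /eqP; rewrite oppr_eq0 => /eqP.
    by have := congr1 (fun q : {poly C} => q`_0) f0;
      rewrite !(coefD, coefMX, coefC) /= !add0r => /eqP; rewrite oppr_eq0 => /eqP.
  rewrite rootE !hornerMXaddC hornerC => /eqP fz; apply/eqP => z1; apply: nE.
  have z0 := circle_neq0 z1.
  (* A root z on the circle gives P(l) = a z + c / z, whereas [EsetE] divides a by the parameter;
     hence the inverse. *)
  rewrite EsetE; exists z^-1; rewrite /= ?Normc.normcV ?z1 ?invr1 // invrK.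
  apply: (mulIf z0); rewrite mulrDl -!mulrA mulVf // mulr1.
  by apply/eqP; rewrite -subr_eq0 -oppr_eq0 -fz; apply/eqP; ring.
have := iso_comp (@iso_shift R (- N%:Z)) isof; congr ell2_iso; apply: funext => u.
rewrite /= fE; apply: funext => n; rewrite /sshift !subrK.
have -> : l * polyop J Q u n - J (polyop J Q u) n =
    - polyop J (Q * ('X - l%:P)) u n.
  by rewrite [Q * _]mulrC polyopM // lXE opprB.
rewrite -PQ polyopD -rmorphN polyopC magic_formula //.
by ring.
Qed.

(** * Truncated Floquet eigenvectors *)

Definition delta (m : int) : V := fun n => (n == m)%:R.

Lemma nsq_delta m : ell2 (delta m) /\ nsq (delta m) <= 1.
Proof.
apply: nsq_finite => s us.
have d0 n : n != m -> Normc.normc (delta m n) ^+ 2 = 0.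
  by rewrite /delta => /negPf ->; rewrite Normc.normc0 expr0n.
have [ms|ms] := boolP (m \in s).
  rewrite (bigD1_seq m) //= big1 => [|n]; last exact: d0.
  by rewrite /delta eqxx Normc.normc1 expr1n addr0.
rewrite big1_seq // => n /andP[_ ns]; apply: d0.
by apply: contraNneq ms => <-.
Qed.

Definition window (M : nat) : V := fun n => (0 <= n < M%:Z)%R%:R.

Lemma ell2_window M : ell2 (window M).
Proof.
elim: M => [|M IH].
  have [n|//] := @nsq_scale _ (delta 0) (window 0) 1 (nsq_delta 0).1 ler01.
  rewrite /window mul1r; have -> : (0 <= n < 0%N%:Z) = false by lia.
  by rewrite Normc.normc0 expr0n sqr_ge0.
have -> : window M.+1 = (fun n => 1 * window M n + delta M%:Z n).
  by apply: funext => n; rewrite /window /delta mul1r -natrD; congr _%:R; lia.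
by apply: ell2_comb => //; exact: (nsq_delta _).1.
Qed.

Lemma nsq_delta_sub (m k : int) :
  ell2 (fun n => delta m n - delta k n) /\ nsq (fun n => delta m n - delta k n) <= 4.
Proof.
have [h1 h2] := nsq_delta m; have [h3 h4] := nsq_delta k.
have [n|h5 h6] := @nsq_comb _ (delta m) (delta k) (fun n => delta m n - delta k n) 2 2 h1 h3
   ltac:(lra) ltac:(lra).
  by rewrite -(normcN (delta k n)); exact: sqr_normcD.
by split=> //; lra.
Qed.

(** The cut-off varies only at its two ends, so the defect of a truncated eigenvector is bounded
    independently of M. *)
Lemma windowS M n : window M (n + 1) - window M n = delta (-1) n - delta (M%:Z - 1) n.
Proof.
have h : window M (n + 1) + delta (M%:Z - 1) n = delta (-1) n + window M n.
  by rewrite /window /delta -!natrD; congr _%:R; lia.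
by rewrite -[window M (n + 1)](addrK (delta (M%:Z - 1) n)) h; ring.
Qed.

Lemma sqr_normc_le (x y z : C) (M L : R) :
  Normc.normc x <= M -> Normc.normc y <= L ->
  Normc.normc (x * y * z) ^+ 2 <= (M * L * Normc.normc z) ^+ 2.
Proof.
move=> xM yL; rewrite !Normc.normcM.
have M0 := le_trans (normc_ge0 x) xM; have L0 := le_trans (normc_ge0 y) yL.
rewrite lerXn2r ?nnegrE ?mulr_ge0 ?normc_ge0 //.
by rewrite ler_wpM2r ?normc_ge0 // ler_pM ?normc_ge0.
Qed.

(** The truncations [v M] have squared norms growing at least linearly in M, whereas (l - J) [v M]
    lives near the two cuts and has squared norm at most [D]. A bounded inverse would bound the
    former by a multiple of the latter. *)
Lemma spectrum_of_floquet u (l w : C) (n0 : nat) :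
    J u = (fun n => l * u n) -> floquet N' w u -> Normc.normc w = 1 ->
  u n0%:Z != 0 -> spectrum J l.
Proof.
move=> Ju fu w1 un0 [S [[_ _ [K SK]] SJ]].
have un n : Normc.normc (u (n + N%:Z)) = Normc.normc (u n).
  by rewrite fu Normc.normcM w1 mul1r.
have [B uB] : exists B : R, forall n, Normc.normc (u n) <= B.
  have [|B hB] := @periodic_bounded R N' (fun n => (Normc.normc (u n))%:C).
    by move=> n; rewrite un.
  exists B => n; have := hB n.
  by rewrite /= expr0n addr0 sqrtr_sqr ger0_norm ?normc_ge0.
have [Ma hMa] := periodic_bounded ha; have [Mc hMc] := periodic_bounded hc.
have B0 : 0 <= B := le_trans (normc_ge0 _) (uB 0).
have Ma0 : 0 <= Ma := le_trans (normc_ge0 _) (hMa 0).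
have Mc0 : 0 <= Mc := le_trans (normc_ge0 _) (hMc 0).
(* Each of the two boundary terms in [fE] contributes the 2 of [sqr_normcD], the square of a
   coefficient bound, and the 4 of [nsq_delta_sub]. *)
pose D := 2 * (Ma * B) ^+ 2 * 4 + 2 * (Mc * B) ^+ 2 * 4.
have D0 : 0 <= D by rewrite addr_ge0 ?mulr_ge0 ?sqr_ge0.
pose v M := fun n => window M n * u n.
pose f M := fun n => l * v M n - J (v M) n.
have hv M : ell2 (v M).
  have [n|//] := @nsq_scale _ (window M) (v M) (B ^+ 2) (ell2_window M) (sqr_ge0 _).
  rewrite /v Normc.normcM exprMn mulrC ler_wpM2r ?sqr_ge0 //.
  by rewrite lerXn2r ?nnegrE ?normc_ge0.
have hf M : ell2 (f M) /\ nsq (f M) <= D.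
  pose d := fun n => window M (n + 1) - window M n.
  have [hd led] : ell2 d /\ nsq d <= 4.
    by rewrite (_ : d = fun n => delta (-1) n - delta (M%:Z - 1) n);
      [exact: nsq_delta_sub | apply: funext => n; exact: windowS].
  have fE n : f M n = - (a n * u (n + 1)) * d n + c (n - 1) * u (n - 1) * d (n - 1).
    have := congr1 (fun x => x n) Ju; rewrite /f /v /jacobi /d subrK /= => e.
    have -> : l * (window M n * u n) = window M n * (l * u n) by ring.
    by rewrite -e; ring.
  have k1 : 0 <= 2 * (Ma * B) ^+ 2 by rewrite mulr_ge0 ?sqr_ge0.
  have k2 : 0 <= 2 * (Mc * B) ^+ 2 by rewrite mulr_ge0 ?sqr_ge0.
  have [n|h1 h2] := @nsq_comb _ d (sshift (-1) d) (f M) _ _ hd (ell2_shift _ hd) k1 k2.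
    rewrite fE; apply: le_trans (sqr_normcD _ _) _.
    apply: lerD; rewrite -[X in _ <= X]mulrA ler_wpM2l // -exprMn.
      by rewrite -mulNr sqr_normc_le // normcN.
    by rewrite sqr_normc_le.
  split=> //; apply: le_trans h2 _; rewrite nsq_shift.
  by apply: lerD; apply: ler_wpM2l.
have vD M : nsq (v M) <= K ^+ 2 * D.
  have [hfM leD] := hf M; have := SK _ hfM; rewrite (SJ _ (hv M)).1 /norm2 => le.
  have : Num.sqrt (nsq (v M)) ^+ 2 <= (K * Num.sqrt (nsq (f M))) ^+ 2.
    by rewrite lerXn2r ?nnegrE ?sqrtr_ge0 //; apply: le_trans le; exact: sqrtr_ge0.
  rewrite exprMn !sqr_sqrtr ?nsq_ge0 // => h; apply: le_trans h _.
  by rewrite ler_wpM2l ?sqr_ge0.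
pose beta : R := Normc.normc (u n0%:Z) ^+ 2.
have beta0 : 0 < beta.
  rewrite exprn_gt0 // lt0r normc_ge0 andbT.
  by apply: contra_neq un0 => /Normc.eq0_normc.
(* The window contains m translates of [n0] by multiples of N, at which |u| takes the same value
   because |w| = 1. *)
have lower m : m%:R * beta <= K ^+ 2 * D.
  pose M := (n0 + m * N)%N; apply: le_trans (vD M).
  pose s := [seq (n0 + k * N)%N%:Z | k <- iota 0 m].
  have us : uniq s.
    rewrite map_inj_uniq ?iota_uniq // => k k' [] /eqP.
    by rewrite eqn_add2l eqn_pmul2r // => /eqP.
  apply: le_trans (nsq_ge_sum (hv M) us); rewrite big_map.
  rewrite (eq_big_seq (fun=> beta)) /= => [|k].
    by rewrite big_const_seq count_predT size_iota iter_addr_0 mulr_natl.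
  rewrite mem_iota add0n /= => km; rewrite /v /window.
  have -> : (0 <= (n0 + k * N)%N%:Z < M%:Z) = true.
    by rewrite /= ltz_nat /M ltn_add2l ltn_pmul2r.
  rewrite mul1r /beta; congr (_ ^+ 2); elim: k {km} => [|k IH].
    by rewrite mul0n addn0.
  by rewrite mulSn addnCA addnC PoszD un IH.
have xD : 0 <= K ^+ 2 * D / beta.
  apply: mulr_ge0; last by rewrite invr_ge0 ltW.
  by apply: mulr_ge0 => //; exact: sqr_ge0.
have := archi_boundP xD; rewrite ltr_pdivrMr // => h.
by have := lt_le_trans h (lower _); rewrite ltxx.
Qed.

Lemma spectrum_of_discriminant (l : C) : Eset a c N P.[l] -> spectrum J l.
Proof.
move=> [t _ /esym Pl].
set A := Jmx a b c N t; set w : C := expi (- t).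
have w1 : Normc.normc w = 1 by exact: expi_circle.
have w0 : w != 0 by exact: circle_neq0.
have : \det (l%:M - A)^T == 0.
  have := discriminantP a b c (ltn0Sn N') t l; rewrite det_tr -/N -/A => ->.
  by rewrite Pl; apply/eqP; ring.
case/det0P => v v0 /(congr1 trmx); rewrite trmx_mul trmxK trmx0.
rewrite mulmxBl mul_scalar_mx => /eqP; rewrite subr_eq0 => /eqP Av.
(* The null vector is extended by powers of the multiplier; n - 1 is divided because matrix index 0
   stands for position 1. *)
pose u (n : int) : C := w ^ ((n - 1) %/ N)%Z * v 0 (inord `|((n - 1) %% N)%Z|%N).
have fu : floquet N' w u.
  move=> n; rewrite /u /N addrAC modzDr [((n - 1 + _) %/ _)%Z]divzDr ?dvdzz //.
  rewrite divzz /= expfzDr // expr1z.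
  by rewrite mulrA [w * _]mulrC.
have uv : period_vec N' u = v^T.
  apply/matrixP => i k; rewrite ord1 !mxE /u.
  have -> : i.+1%:Z - 1 = i%:Z by lia.
  rewrite divz_small ?expr0z ?mul1r ?modz_small ?ltz_nat ?ltn_ord //=.
  by rewrite inord_val.
have [i vi] : exists i, v 0 i != 0.
  apply/existsP; apply: contraNT v0 => /existsPn h.
  by apply/eqP/rowP => i; rewrite mxE; apply/eqP; rewrite -[_ == _]negbK h.
apply: (@spectrum_of_floquet u l w i.+1) => //; last first.
  by have /matrixP/(_ i 0) := uv; rewrite !mxE => ->.
have fJ : floquet N' w (J u) := floquet_jacobi ha hb hc fu.
have fl : floquet N' w (fun n => l * u n) by move=> n; rewrite fu mulrCA.
apply: (period_vec_inj fJ fl w0).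
rewrite (@period_vec_jacobi _ a b c N' hc t) // uv -/A -Av.
by apply/matrixP => j k; rewrite -uv !mxE.
Qed.

Theorem spectrumE : ~ (pa = 0 /\ pc = 0) ->
  spectrum J = [set l | Eset a c N P.[l]].
Proof.
move=> hac; apply/seteqP; split=> l; last exact: spectrum_of_discriminant.
by move=> sl; apply: contrapT => /(resolvent_of_discriminant hac).
Qed.

End Spectrum.

(** * Preimages of ellipses *)

Section Ellipse.
Variable R : realType.
Local Notation C := R[i].
Implicit Types (p : {poly C}) (A B z w l : C).

(** Beyond the sum of the moduli of the roots plus L, every factor l - z has modulus at least L,
    where L >= 1 and L > M. *)
Lemma monic_unbounded p (M : R) : p \is monic -> (1 < size p)%N ->
  exists T : R, forall l, T <= Normc.normc l -> M < Normc.normc p.[l].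
Proof.
move=> pm; have [r pr] := closed_field_poly_normal p.
rewrite (monicP pm) scale1r in pr; rewrite pr size_prod_XsubC ltnS => r0.
pose L := Num.max M 0 + 1; have L1 : 1 <= L by rewrite lerDr le_max lexx orbT.
have ML : M < L.
  by rewrite (@le_lt_trans _ _ (Num.max M 0)) ?le_max ?lexx // ltrDl ltr01.
exists (\sum_(z <- r) Normc.normc z + L) => l hl.
suff h : L ^+ size r <= Normc.normc (\prod_(z <- r) ('X - z%:P)).[l].
  apply: lt_le_trans ML (le_trans _ h).
  by case: (size r) r0 => // n _; rewrite exprS ler_peMr ?exprn_ege1 // (le_trans ler01).
have {hl} : forall z, z \in r -> L <= Normc.normc (l - z).
  move=> z zr; have := le_normcD (l - z) z; rewrite subrK => h.
  have : Normc.normc z <= \sum_(z <- r) Normc.normc z.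
    by rewrite (big_rem z) //= lerDl sumr_ge0 // => ? _; exact: normc_ge0.
  lra.
elim: r {pr r0} => [|z r IH] hr; first by rewrite big_nil hornerC Normc.normc1.
rewrite big_cons hornerM hornerXsubC Normc.normcM /= exprS.
apply: ler_pM; rewrite ?exprn_ge0 ?(le_trans ler01) //.
  by apply: hr; rewrite mem_head.
by apply: IH => x xr; apply: hr; rewrite in_cons xr orbT.
Qed.

Lemma normc2J z : (Normc.normc z ^+ 2)%:C = z * z^*%C.
Proof.
case: z => x y /=; rewrite sqr_sqrtr ?addr_ge0 ?sqr_ge0 //.
by apply/eqP; rewrite eq_complex /=; apply/andP; split; apply/eqP; ring.
Qed.

Lemma conj_normal A B w :
  (B^*%C * w - A * w^*%C)^*%C = B * w^*%C - A^*%C * w.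
Proof. by rewrite rmorphB !rmorphM; congr (_ * _ - _ * _); exact: conjcK. Qed.

(* The real-linear map w |-> conj B * w - A * conj w sends A / z + B * z
   (|z| = 1) to (|B|^2 - |A|^2) * z. *)
Lemma ellipse_normal A B w (d := Normc.normc B ^+ 2 - Normc.normc A ^+ 2) :
    d != 0 -> Normc.normc (B^*%C * w - A * w^*%C) ^+ 2 = d ^+ 2 ->
  exists2 z, Normc.normc z = 1 & w = A / z + B * z.
Proof.
move=> d0 e; pose v := B^*%C * w - A * w^*%C.
have dC0 : d%:C != 0 by rewrite -(rmorph0 (real_complex R)) (inj_eq (@complexI R)).
have dE : d%:C = B * B^*%C - A * A^*%C by rewrite rmorphB /= -!normc2J.
have z1 : Normc.normc (v / d%:C) = 1.
  apply/eqP; rewrite -(@pexpr_eq1 _ _ 2) ?normc_ge0 //.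
  rewrite Normc.normcM exprMn e Normc.normcV /= expr0n addr0 sqrtr_sqr exprVn.
  by rewrite real_normK ?num_real // mulfV // expf_neq0.
exists (v / d%:C) => //; rewrite (circleV z1).
have -> : (v / d%:C)^*%C = v^*%C / d%:C by rewrite rmorphM fmorphV; congr (_ / _); exact: conjc_real.
apply: (mulIf dC0); rewrite mulrDl !mulrA !divfK //.
by rewrite conj_normal dE /v; ring.
Qed.

(** With v = conj(B) w - A conj(w), inversion gives d w = B v + A conj(v), so |v| <= |d| bounds w.
    The region in question is the one enclosed by the ellipse. *)
Lemma ellipse_bound A B w (d := Normc.normc B ^+ 2 - Normc.normc A ^+ 2) :
    d != 0 -> Normc.normc (B^*%C * w - A * w^*%C) ^+ 2 <= d ^+ 2 ->
  Normc.normc w <= Normc.normc A + Normc.normc B.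
Proof.
move=> d0; set v := B^*%C * w - A * w^*%C => le.
have dE : d%:C = B * B^*%C - A * A^*%C by rewrite rmorphB /= -!normc2J.
have dw : d%:C * w = B * v + A * v^*%C.
  by rewrite conj_normal dE /v; ring.
have vJ : Normc.normc v^*%C = Normc.normc v.
  by case: (v) => x y /=; rewrite sqrrN.
have dn0 : 0 < `|d| by rewrite normr_gt0.
have vd : Normc.normc v <= `|d|.
  by rewrite -(normr_id d) -(ger0_norm (normc_ge0 v)) -ler_sqr ?nnegrE // !real_normK ?num_real.
rewrite -(ler_pM2l dn0).
have -> : `|d| * Normc.normc w = Normc.normc (B * v + A * v^*%C).
  by rewrite -dw Normc.normcM /= expr0n addr0 sqrtr_sqr.
apply: le_trans (le_normcD _ _) _; rewrite !Normc.normcM vJ.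
have := normc_ge0 A; have := normc_ge0 B; have := normc_ge0 v.
move: (Normc.normc A) (Normc.normc B) (Normc.normc v) vd => x y t; nra.
Qed.

Lemma ellipse_preimage_not_real A B p : p \is monic -> (1 < size p)%N ->
    Normc.normc A != Normc.normc B ->
  exists l, complex.Im l != 0 /\
    exists2 z, Normc.normc z = 1 & p.[l] = A / z + B * z.
Proof.
move=> pm szp AB; pose d := Normc.normc B ^+ 2 - Normc.normc A ^+ 2.
have d0 : d != 0.
  by rewrite subr_eq0 eqrXn2 ?normc_ge0 // eq_sym.
have /closed_rootP[l0 /rootP pl0] : size p != 1%N by rewrite gtn_eqF.
(* The ray points away from the real axis, so all its points with positive parameter are
   non-real. *)
pose e : R := if 0 <= complex.Im l0 then 1 else -1.
pose ray (t : R) : C := l0 + (0 +i* e) * t%:C.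
have [re [im pE]] := poly_ReIm (p \Po (l0%:P + (0 +i* e) *: 'X)).
have pray t : p.[ray t] = re.[t] +i* im.[t].
  have := congr1 (fun q => q.[t%:C]) pE.
  rewrite /= horner_comp !hornerD !hornerZ hornerC hornerX !horner_map /= => ->.
  by apply/eqP; rewrite eq_complex /=; apply/andP; split; apply/eqP; ring.
(* [m] and [n] are the images of 1 and i under w -> conj(B) w - A conj(w), so a zero of [F] marks a
   point of the ray that p sends onto the ellipse. F is negative at the root of p and, by
   [ellipse_bound], nonnegative where |p| is large. *)
pose m := B^*%C - A; pose n := 'i%C * (B^*%C + A).
pose f1 := complex.Re m *: re + complex.Re n *: im.
pose f2 := complex.Im m *: re + complex.Im n *: im.
pose F := f1 ^+ 2 + f2 ^+ 2 - (d ^+ 2)%:P.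
have FE t : F.[t] = Normc.normc (B^*%C * p.[ray t] - A * (p.[ray t])^*%C) ^+ 2 - d ^+ 2.
  rewrite pray /F /f1 /f2 /m /n; case: (A) (B) => a1 a2 [b1 b2].
  rewrite /= sqr_sqrtr ?addr_ge0 ?sqr_ge0 // !hornerE /=; ring.
have F0 : F.[0] < 0.
  rewrite FE /ray mulr0 addr0 pl0 rmorph0 !mulr0 subrr Normc.normc0 expr0n sub0r.
  by rewrite oppr_lt0 lt0r sqrf_eq0 d0 sqr_ge0.
have [T hT] := monic_unbounded (Normc.normc A + Normc.normc B) pm szp.
pose t := `|T| + Normc.normc l0.
have t0 : 0 <= t by rewrite addr_ge0 ?normc_ge0.
have Ft : 0 <= F.[t].
  rewrite leNgt; apply/negP; rewrite FE subr_lt0 => /ltW h.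
  have := ellipse_bound d0 h; rewrite leNgt hT //.
  have e1 : Normc.normc (0 +i* e) = 1.
    by apply/circleP; rewrite /e; case: ifP => _; ring.
  have := le_normcD (ray t) (- l0).
  rewrite /ray addrAC subrr add0r Normc.normcM e1 mul1r normcN /=.
  rewrite expr0n addr0 sqrtr_sqr (ger0_norm t0) /t.
  have := ler_norm T; lra.
have Fs : F.[0] * F.[t] <= 0 by apply: mulr_le0_ge0 => //; exact: ltW.
have [s] := @polyrcf.poly_ivt _ F 0 t t0 Fs => {Fs}.
rewrite in_itv /= => /andP[s0 _] /rootP Fs.
have sn0 : s != 0 by apply: contraTneq F0 => s00; move: Fs; rewrite s00 => ->; rewrite ltxx.
have sp : 0 < s by rewrite lt0r sn0.
exists (ray s); split; last first.
  apply: (@ellipse_normal A B _ d0); apply/eqP; rewrite -subr_eq0 -/d -FE.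
  by rewrite Fs.
have -> : complex.Im (ray s) = complex.Im l0 + e * s.
  by rewrite /ray; case: (l0) => x y /=; rewrite mul0r add0r.
move: (complex.Im l0) @e {ray pray FE F0 Ft Fs pE} => y; rewrite /=.
case: leP => h; first by rewrite gt_eqF // mul1r ltr_wpDl.
by rewrite lt_eqF // mulN1r subr_lt0 (lt_trans h).
Qed.

End Ellipse.

(** * Normalization *)

Section Segments.
Variable R : realType.
Local Notation C := R[i].
Implicit Types (x z w l s : C).

Lemma realcE (t u : R) : (t%:C == u%:C) = (t == u).
Proof. exact: (inj_eq (@complexI R)). Qed.

Lemma real_segment_affine (alpha beta : R) x : alpha < beta ->
  real_segment alpha beta (((alpha + beta) / 2)%:C + ((beta - alpha) / 4)%:C * x) <->
  real_segment (-2) 2 x.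
Proof.
move=> ab; have h0 : 0 < (beta - alpha) / 4 by lra.
rewrite !real_segmentP; split=> [[t [t1 t2 e]]|[t [t1 t2 ->]]].
  exists ((t - (alpha + beta) / 2) / ((beta - alpha) / 4)); split.
  - by rewrite ler_pdivlMr //; lra.
  - by rewrite ler_pdivrMr //; lra.
  rewrite rmorphM fmorphV rmorphB /= -e addrAC subrr add0r mulrC mulKf //.
  by rewrite -(rmorph0 (real_complex R)) realcE gt_eqF.
exists ((alpha + beta) / 2 + (beta - alpha) / 4 * t); split; [nra|nra|].
by rewrite [RHS]rmorphD; congr (_ + _); rewrite -rmorphM.
Qed.

Lemma real_segment_scale (r : R) x : 0 < r ->
  real_segment (- (2 * r)) (2 * r) (r%:C * x) <-> real_segment (-2) 2 x.
Proof.
move=> r0; have := @real_segment_affine (- (2 * r)) (2 * r) x ltac:(lra).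
have -> : (- (2 * r) + 2 * r) / 2 = 0 by field.
have -> : (2 * r - - (2 * r)) / 4 = r by field.
by rewrite add0r.
Qed.

Lemma real_segmentN x : real_segment (-2) 2 (- x) <-> real_segment (-2) 2 x.
Proof.
suff h y : real_segment (-2) 2 y -> real_segment (-2 : R) 2 (- y).
  by split=> [/h|/h //]; rewrite opprK.
rewrite !real_segmentP => -[t [t1 t2 ->]]; exists (- t); split; [lra|lra|].
by rewrite rmorphN.
Qed.

(** Substituting y = B z / s, again of modulus 1, turns A / z + B z into s (y + 1/y), so the ellipse
    collapses to s [-2, 2]. *)
Lemma degenerate_ellipse (A B s w : C) : s ^+ 2 = A * B -> s != 0 ->
    Normc.normc A = Normc.normc B ->
  (exists2 z, Normc.normc z = 1 & w = A / z + B * z) <-> real_segment (-2) 2 (s^-1 * w).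
Proof.
move=> s2 s0 AB.
have B0 : B != 0 by apply: contra_neq s0 => B0; apply/eqP; rewrite -sqrf_eq0 s2 B0 mulr0.
have sB : Normc.normc s = Normc.normc B.
  apply/eqP; rewrite -(@eqrXn2 _ 2) ?normc_ge0 // -normcX s2 Normc.normcM AB.
  by rewrite expr2.
have nB : Normc.normc B != 0 by apply: contra_neq B0 => /Normc.eq0_normc.
have AE : A = s ^+ 2 / B by rewrite s2 mulfK.
split=> [[z z1 ->]|].
  have z0 := circle_neq0 z1; pose y := B * z / s.
  have y0 : y != 0 by rewrite !mulf_neq0 ?invr_eq0.
  have -> : s^-1 * (A / z + B * z) = y + y^-1.
    by rewrite AE /y; field; rewrite s0 B0 z0.
  by apply/joukowski_circle => //; rewrite !Normc.normcM Normc.normcV z1 sB mulr1 mulfV.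
have [y y0 wy] := joukowski_surj (s^-1 * w).
rewrite wy => /joukowski_circle => /(_ y0) y1; exists (s * y / B).
  by rewrite !Normc.normcM Normc.normcV y1 sB mulr1 mulfV.
rewrite -[w](mulVKf s0) wy AE; field; by rewrite s0 B0 y0.
Qed.

End Segments.

(** * Rescaling the band to [-2, 2] *)

Section Band.
Variables (R : realType) (P : {poly R[i]}) (A B : R[i]) (N' : nat) (alpha beta : R).
Local Notation C := R[i].
Let E : set C := [set A / z + B * z | z in [set z : C | Normc.normc z = 1]].
Let h : R := (beta - alpha) / 4.
Let mid : R := (alpha + beta) / 2.
Hypotheses (ab : alpha < beta) (AB : ~ (A = 0 /\ B = 0)).
Hypotheses (Pm : P \is monic) (szP : size P = N'.+2).

Lemma h_gt0 : 0 < h. Proof. by rewrite divr_gt0 ?subr_gt0 ?ltr0n. Qed.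

Lemma hc_neq0 : h%:C != 0.
Proof. by rewrite -(rmorph0 (real_complex R)) realcE gt_eqF // h_gt0. Qed.

Lemma band_chebyshev :
    (forall l, E P.[l] <-> real_segment alpha beta l) ->
  E = real_segment (- (2 * h ^+ N'.+1)) (2 * h ^+ N'.+1) /\
  (forall l, P.[l] = (h ^+ N'.+1)%:C *
     (map_poly (real_complex R) (PN R N'.+1)).[h^-1%:C * (l - mid%:C)]).
Proof.
move=> EP; have h0 := h_gt0; have hc0 := hc_neq0.
have nAB : Normc.normc A = Normc.normc B.
  apply/eqP; apply: contraT => nAB.
  have [|l [Iml [z z1 Pl]]] := ellipse_preimage_not_real Pm _ nAB; first by rewrite szP.
  have /EP/real_segmentP[t [_ _ lt]] : E P.[l] by exists z => //; rewrite Pl.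
  by move: Iml; rewrite lt /= eqxx.
have AB0 : A != 0 /\ B != 0.
  split; apply/eqP => e0; apply: AB; split=> //; apply: Normc.eq0_normc.
    by rewrite -nAB e0 Normc.normc0.
  by rewrite nAB e0 Normc.normc0.
pose s := sqrtc (A * B).
have s2 : s ^+ 2 = A * B by rewrite sqr_sqrtc.
have s0 : s != 0 by rewrite -sqrf_eq0 s2 mulf_neq0 ?AB0.1 ?AB0.2.
have EE w : E w <-> real_segment (-2) 2 (s^-1 * w).
  rewrite -(degenerate_ellipse w s2 s0 nAB).
  by split=> -[z z1 e]; exists z.
(* [L] maps [-2, 2] onto [alpha, beta], so s^-1 P(L(x)) satisfies the hypothesis of
   [chebyshev_unique]. *)
pose L : {poly C} := h%:C *: 'X + mid%:C%:P.
have szL : size L = 2%N.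
  by rewrite size_polyDl size_scale // size_polyX // (leq_ltn_trans (size_polyC_leq1 _)).
have LE x : L.[x] = mid%:C + h%:C * x by rewrite hornerD hornerZ hornerX hornerC addrC.
have szQ : size (s^-1 *: (P \Po L)) = N'.+2.
  by rewrite size_scale ?invr_eq0 // size_comp_poly2.
have [x|k [k1 QE]] := chebyshev_unique szQ.
  by rewrite hornerZ horner_comp LE -EE EP real_segment_affine.
have PLE : P \Po L = (s * k%:C) *: map_poly (real_complex R) (PN R N'.+1).
  by rewrite -scalerA -QE scalerA mulfV // scale1r.
have [szPN mPN] := PN_lead R N'.
(* Leading coefficients are compared: P is monic and [L] has slope h. So s is h^N up to the sign
   [k], and a segment symmetric about 0 does not see that sign. *)
have sk : s * k%:C = (h ^+ N'.+1)%:C.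
  have := congr1 lead_coef PLE.
  rewrite lead_coef_comp ?szL // (monicP Pm) mul1r szP lead_coefZ lead_coef_map.
  rewrite (monicP mPN) rmorph1 mulr1 => <-.
  rewrite lead_coefDl ?size_scale ?size_polyX // ?(leq_ltn_trans (size_polyC_leq1 _)) //.
  by rewrite lead_coefZ lead_coefX mulr1 rmorphXn.
split.
  have hN0 : 0 < h ^+ N'.+1 by rewrite exprn_gt0.
  apply/seteqP; suff EEw w : E w <-> real_segment (- (2 * h ^+ N'.+1)) (2 * h ^+ N'.+1) w.
    by split=> w /EEw.
  rewrite EE -[w in X in _ <-> X](mulVKf s0).
  have -> : s = (h ^+ N'.+1)%:C * k%:C.
    rewrite -sk -mulrA -rmorphM; case: k1 => ->; first by rewrite mulr1 rmorph1 mulr1.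
    by rewrite mulrNN mulr1 rmorph1 mulr1.
  rewrite -[X in _ <-> real_segment _ _ X]mulrA real_segment_scale //.
  by case: k1 => ->; rewrite ?rmorphN rmorph1 ?mul1r // mulN1r real_segmentN.
move=> l; rewrite -sk -hornerZ -PLE horner_comp LE fmorphV mulVKf //.
by rewrite addrC subrK.
Qed.

Lemma chebyshev_band l :
    E = real_segment (- (2 * h ^+ N'.+1)) (2 * h ^+ N'.+1) ->
    P.[l] = (h ^+ N'.+1)%:C *
     (map_poly (real_complex R) (PN R N'.+1)).[h^-1%:C * (l - mid%:C)] ->
  E P.[l] <-> real_segment alpha beta l.
Proof.
move=> -> ->; have hN0 : 0 < h ^+ N'.+1 by rewrite exprn_gt0 // h_gt0.
rewrite real_segment_scale // PN_preimage //.
rewrite -(real_segment_affine _ ab) -/h -/mid fmorphV mulVKf ?hc_neq0 //.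
by rewrite addrC subrK.
Qed.

End Band.

Theorem theorem1p5 (R : realType) (N : nat) (hN : (1 <= N)%N)
    (a b c : int -> R[i])
    (ha : seq_periodic N a) (hb : seq_periodic N b) (hc : seq_periodic N c)
    (hac : ~ (period_prod N a = 0 /\ period_prod N c = 0))
    (alpha beta : R) (hab : alpha < beta) :
  let r : R := ((beta - alpha) / 4) ^+ N in
  spectrum (jacobi a b c) = real_segment alpha beta <->
  Eset a c N = real_segment (- (2 * r)) (2 * r) /\
  (forall lambda : R[i],
     (discriminant a b c N).[lambda] =
     r%:C * (map_poly (real_complex R) (PN R N)).[
       (4 / (beta - alpha))%:C * (lambda - ((alpha + beta) / 2)%:C)]).
Proof.
case: N hN ha hb hc hac => // N' _ ha hb hc hac r.
have [szP Pm] := discriminant_lead a b c (ltn0Sn N').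
rewrite (spectrumE ha hb hc hac) EsetE -[4 / (beta - alpha)]invf_div.
split=> [S|[EE PE]].
  apply: band_chebyshev => // l.
  by have := congr1 (fun X => X l) S; rewrite /= => ->.
by apply/seteqP; split=> l /(chebyshev_band hab EE (PE l)).
Qed.
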